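(* Let $M$ be a connected properly immersed minimal surface in $\mathbb{R}^3$, possibly with boundary. Then $$M(+)=\{(x_1,x_2,x_3)\in M\mid x_3\ge 0\}$$ (assumed to have nonempty boundary) is parabolic.
   Context: A Riemannian surface with (nonempty) boundary is called parabolic if bounded harmonic functions on the surface are determined by their boundary values, i.e. two bounded functions that are continuous on the surface, harmonic in its interior, and equal on the boundary are identical. Equivalently, for every interior point $p$ the harmonic (hitting) measure $\mu_p$ on the boundary is full: the total mass $\int d\mu_p$ over the boundary equals $1$, where $\mu_p(I)$ is the probability that a Brownian path starting at $p$ hits the boundary for the first time at a point of $I$. The surface $M(+)$ carries the metric induced by the immersion in $\mathbb{R}^3$; for an immersed surface, $M(+)$ is the set of points of the domain surface at which the third coordinate function is nonnegative. The boundary of $M(+)$ consists of the points of $\partial M$ with $x_3\ge 0$ together with the points of $M$ with $x_3=0$. *)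

(* Defs.v *)
From HB Require Import structures.
From mathcomp Require Import all_boot all_order all_algebra.
From mathcomp Require Import all_classical all_reals all_analysis.
Set Implicit Arguments.
Unset Strict Implicit.
Unset Printing Implicit Defensive.
Import Order.TTheory GRing.Theory Num.Theory.
Import numFieldNormedType.Exports.
Local Open Scope classical_set_scope.
Local Open Scope ring_scope.

Section Calculus.
Context {R : realType}.

Definition axis (i : 'I_2) : 'rV[R]_2 := delta_mx 0 i.

(* Meaningful for [U] open: ['D_(axis i) f] is then, on [U], determined by the
   restriction of [f] to [U]. *)
Fixpoint Ck {V : normedModType R} (k : nat) (U : set 'rV[R]_2)
    (f : 'rV[R]_2 -> V) : Prop :=
  (forall x, U x -> {for x, continuous f}) /\
  match k with
  | 0%N => True
  | k'.+1 => forall i : 'I_2,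
      (forall x, U x -> derivable f x (axis i)) /\ Ck k' U ('D_(axis i) f)
  end.

Definition smooth_on {V : normedModType R} (U : set 'rV[R]_2)
  (f : 'rV[R]_2 -> V) : Prop := forall k, Ck k U f.

Definition half_plane : set 'rV[R]_2 := [set x : 'rV[R]_2 | 0 <= x 0 1].

(* [F] extends [g] smoothly from [S] to a full neighbourhood of [x] in the
   plane.  When [S] is relatively open in the half-plane, all the partial
   derivatives of [F] at a point [x] of [S] are determined by [g], since [S] is
   contained in the closure of its interior. *)
Definition smooth_extension {V : normedModType R} (S : set 'rV[R]_2)
    (g : 'rV[R]_2 -> V) (x : 'rV[R]_2) (F : 'rV[R]_2 -> V) : Prop :=
  exists O : set 'rV[R]_2,
    [/\ open O, O x, smooth_on O F & forall y, O y -> S y -> F y = g y].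

Definition smooth_in {V : normedModType R} (S : set 'rV[R]_2)
    (g : 'rV[R]_2 -> V) : Prop :=
  forall x, S x -> exists F, smooth_extension S g x F.

Definition dot (u v : 'rV[R]_3) : R := \sum_k u 0 k * v 0 k.

(* The indices in ['I_3] are added modulo 3. *)
Definition cross (u v : 'rV[R]_3) : 'rV[R]_3 :=
  \row_k (u 0 (k + 1) * v 0 (k + 2) - u 0 (k + 2) * v 0 (k + 1)).

Definition first_form (F : 'rV[R]_2 -> 'rV[R]_3) (x : 'rV[R]_2) : 'M[R]_2 :=
  \matrix_(i, j) dot ('D_(axis i) F x) ('D_(axis j) F x).

Definition unit_normal (F : 'rV[R]_2 -> 'rV[R]_3) (x : 'rV[R]_2) : 'rV[R]_3 :=
  let n := cross ('D_(axis 0) F x) ('D_(axis 1) F x) in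
  (Num.sqrt (dot n n))^-1 *: n.

Definition second_form (F : 'rV[R]_2 -> 'rV[R]_3) (x : 'rV[R]_2) : 'M[R]_2 :=
  \matrix_(i, j) dot ('D_(axis i) ('D_(axis j) F) x) (unit_normal F x).

Definition mean_curvature (F : 'rV[R]_2 -> 'rV[R]_3) (x : 'rV[R]_2) : R :=
  \tr (invmx (first_form F x) *m second_form F x) / 2.

Definition laplace_beltrami (G : 'rV[R]_2 -> 'M[R]_2) (u : 'rV[R]_2 -> R)
    (x : 'rV[R]_2) : R :=
  (Num.sqrt (\det (G x)))^-1 *
  \sum_i 'D_(axis i) (fun y => Num.sqrt (\det (G y)) *
    \sum_j invmx (G y) i j * 'D_(axis j) u y) x.

End Calculus.

(* Charts take values in the closed half-plane; [cinv] is only relevant on the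
   image of the chart. *)
Record chart (R : realType) (M : topologicalType) := Chart {
  cdom : set M;
  cmap : M -> 'rV[R]_2;
  cinv : 'rV[R]_2 -> M;
  cdom_open : open cdom;
  cimage_open : exists2 O : set 'rV[R]_2,
    open O & cmap @` cdom = O `&` half_plane;
  cmapK : {in cdom, cancel cmap cinv};
  cmap_continuous : {within cdom, continuous cmap};
  cinv_continuous : {within cmap @` cdom, continuous cinv}
}.

Record surface (R : realType) := Surface {
  carrier :> topologicalType;
  atlas : set (chart R carrier);
  surface_hausdorff : hausdorff_space carrier;
  surface_second_countable : @second_countable carrier;
  atlas_cover : forall p : carrier, exists2 c, atlas c & cdom c p;
  atlas_compatible : forall c1 c2, atlas c1 -> atlas c2 ->
    smooth_in (cmap c1 @` (cdom c1 `&` cdom c2)) (cmap c2 \o cinv c1)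
}.

Section Surfaces.
Context {R : realType} {M : surface R}.
Implicit Types (c : chart R M) (p : M) (f : M -> 'rV[R]_3) (S B W : set M).

Definition cimage c : set 'rV[R]_2 := cmap c @` cdom c.

Definition surface_interior : set M :=
  [set p | exists c, [/\ atlas c, cdom c p & 0 < cmap c p 0 1]].

Definition surface_boundary : set M := ~` surface_interior.

Definition smooth_map f : Prop :=
  forall c, atlas c -> smooth_in (cimage c) (f \o cinv c).

(* The quantification over extensions [F] is a way to speak of the derivatives
   of [f \o cinv c] also at boundary points. *)
Definition immersion f : Prop :=
  smooth_map f /\
  forall c x F, atlas c -> cimage c x ->
    smooth_extension (cimage c) (f \o cinv c) x F ->
    free [:: 'D_(axis 0) F x; 'D_(axis 1) F x].

Definition minimal f : Prop :=
  forall c x F, atlas c -> cimage c x ->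
    smooth_extension (cimage c) (f \o cinv c) x F -> mean_curvature F x = 0.

Definition proper_map f : Prop :=
  forall K : set 'rV[R]_3, compact K -> compact (f @^-1` K).

Definition induced_metric f c : 'rV[R]_2 -> 'M[R]_2 := first_form (f \o cinv c).

(* [g c] is the matrix of a Riemannian metric in the chart [c], and [W] is an
   open set of interior points of the surface. *)
Definition harmonic_on (g : chart R M -> 'rV[R]_2 -> 'M[R]_2) W (u : M -> R)
    : Prop :=
  forall c, atlas c ->
    let V := cmap c @` (cdom c `&` W) in
    Ck 2 V (u \o cinv c : 'rV[R]_2 -> R^o) /\
    forall x, V x -> laplace_beltrami (g c) (u \o cinv c) x = 0.

(* Parabolicity of the subset [S] of [M], regarded as a Riemannian surface with
   boundary [B]. *)
Definition parabolic (g : chart R M -> 'rV[R]_2 -> 'M[R]_2) S B : Prop :=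
  forall u v : M -> R,
    [bounded u p : R^o | p in S] -> [bounded v p : R^o | p in S] ->
    {within S, continuous u} -> {within S, continuous v} ->
    harmonic_on g (S `\` B) u -> harmonic_on g (S `\` B) v ->
    (forall p, B p -> u p = v p) -> forall p, S p -> u p = v p.

Definition x3 f p : R := f p 0 2.

Definition Mplus f : set M := [set p | 0 <= x3 f p].

Definition Mplus_boundary f : set M :=
  (surface_boundary `&` Mplus f) `|` [set p | x3 f p = 0].

End Surfaces.

(* Main.v *)
Require Import Defs.
From HB Require Import structures.
From mathcomp Require Import all_boot all_order all_algebra.
From mathcomp Require Import all_classical all_reals all_analysis.
From mathcomp Require Import ring lra.
Set Implicit Arguments.
Unset Strict Implicit.
Unset Printing Implicit Defensive.
Import Order.TTheory GRing.Theory Num.Theory.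
Import numFieldNormedType.Exports.
Local Open Scope classical_set_scope.
Local Open Scope ring_scope.

(** Let u and v be bounded, continuous on M(+), harmonic in its interior and
    equal on its boundary, and let C bound u - v.  By symmetry it is enough to
    show that u <= v.

    On the slab 0 <= x3 <= N consider w = u - v - (C / N) x3 ([tilted]).  The
    coordinate functions of a minimal immersion are harmonic
    ([coordf_harmonic]), so w is harmonic.  It is nonpositive on the boundary of
    the slab: there either u = v, or x3 = N and the linear term compensates C.
    If w <= 0 on every slab ([tilted_nonpos]), then N can be sent to infinity at
    a fixed point, which gives u <= v ([comparison]).

    The slab need not be compact, and the maximum principle needs control at
    infinity.  It comes from h = log r - x3^2, where r is the distance to the
    vertical axis: on a minimal surface the Laplacian of log r is at most
    |grad x3|^2 / r^2, while that of x3^2 is 2 |grad x3|^2, so that h is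
    superharmonic where r >= 1 ([log_barrier_superharmonic]).  As the immersion
    is proper, h tends to infinity at infinity in the slab, and w - e h attains
    its maximum on the part r >= 1 for every e > 0.  This maximum cannot be at
    an interior point of that part; for e small enough it follows that w is
    bounded on the slab by 0 or by its maximum over the part r <= 1
    ([tilted_le_cylinder_max]).  That part is compact, so a positive supremum of
    w would be attained, again at an interior point.

    Interior maxima are excluded by the strong maximum principle
    ([no_interior_max]): the set of maximum points is closed, and it is open by
    Hopf's theorem ([hopf]), so by connectedness it is all of M, although a
    boundary point of M(+) does not belong to it.

    Everything else is computed in charts.  Interior points have charts with
    values in the open half-plane, where the Laplace-Beltrami operator is an
    elliptic operator with continuous coefficients
    ([laplace_beltrami_diffop]). *)

(** * Calculus of functions of class C^k on the plane *)

Section CkCalculus.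
Context {R : realType}.
Implicit Types (U : set 'rV[R]_2) (x : 'rV[R]_2) (i j : 'I_2).

Lemma Ck_continuous {V : normedModType R} k U (f : 'rV[R]_2 -> V) x :
  Ck k U f -> U x -> {for x, continuous f}.
Proof. by case: k => [|k] [fc _]; exact: fc. Qed.

Lemma Ck_derivable {V : normedModType R} k U (f : 'rV[R]_2 -> V) i x :
  Ck k.+1 U f -> U x -> derivable f x (axis i).
Proof. by case=> _ /(_ i)[+ _]; exact. Qed.

Lemma Ck_derive {V : normedModType R} k U (f : 'rV[R]_2 -> V) i :
  Ck k.+1 U f -> Ck k U ('D_(axis i) f).
Proof. by case=> _ /(_ i)[]. Qed.

Lemma Ck_pred {V : normedModType R} k U (f : 'rV[R]_2 -> V) :
  Ck k.+1 U f -> Ck k U f.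
Proof.
elim: k f => [|k IH] f [fc fD]; first by split.
by split=> // i; have [fi /IH ?] := fD i; split.
Qed.

Lemma Ck_subset {V : normedModType R} k U U' (f : 'rV[R]_2 -> V) :
  U' `<=` U -> Ck k U f -> Ck k U' f.
Proof.
move=> sub; elim: k f => [|k IH] f [fc fD].
  by split=> // x /sub; exact: fc.
split=> [x /sub|i]; first exact: fc.
by have [fi /IH ?] := fD i; split => // x /sub; exact: fi.
Qed.

Lemma open_near_eq {V : Type} U (f g : 'rV[R]_2 -> V) x : open U -> U x ->
  (forall y, U y -> f y = g y) -> \near x, f x = g x.
Proof.
by move=> oU Ux fg; near=> y; apply: fg; near: y; exact: open_nbhs_nbhs.
Unshelve. all: by end_near. Qed.

Lemma near_eq_continuous {T : topologicalType} {V : topologicalType}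
    (f g : T -> V) (x : T) :
  (\near x, f x = g x) -> {for x, continuous f} -> {for x, continuous g}.
Proof.
move=> fg fc; have e := nbhs_singleton fg.
rewrite /prop_for /continuous_at -e.
by apply: cvg_trans fc; exact: near_eq_cvg.
Qed.

Lemma Ck_eq {V : normedModType R} k U (f g : 'rV[R]_2 -> V) : open U ->
  (forall x, U x -> f x = g x) -> Ck k U f -> Ck k U g.
Proof.
move=> oU; elim: k f g => [|k IH] f g fg [fc fD].
  split=> // x Ux.
  exact: near_eq_continuous (open_near_eq oU Ux fg) (fc x Ux).
split=> [x Ux|i].
  exact: near_eq_continuous (open_near_eq oU Ux fg) (fc x Ux).
have [fi Dfi] := fD i; split=> [x Ux|].
  by apply: near_eq_derivable (fi x Ux); exact: open_near_eq oU Ux fg.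
apply: IH Dfi => x Ux.
exact: near_eq_derive (open_near_eq oU Ux fg).
Qed.

(** On an open set the partial derivatives may be replaced by any formula that
    is valid there; this reduces each closure property of C^k to one rule of
    differentiation. *)
Lemma CkSP {V : normedModType R} k U (f : 'rV[R]_2 -> V)
    (df : 'I_2 -> 'rV[R]_2 -> V) : open U ->
  (forall x, U x -> {for x, continuous f}) ->
  (forall i x, U x -> is_derive x (axis i) f (df i x)) ->
  (forall i, Ck k U (df i)) -> Ck k.+1 U f.
Proof.
move=> oU fc fd dfC; split=> // i; split=> [x /(fd i)[]//|].
by apply: Ck_eq (dfC i) => // x /(fd i)[_ ->].
Qed.

Lemma Ck_cst {V : normedModType R} k U (a : V) : open U ->
  Ck k U (fun _ : 'rV[R]_2 => a).
Proof.
move=> oU; elim: k a => [|k IH] a; first by split=> //= x _; apply: cst_continuous.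
apply: (CkSP (df := fun _ _ => 0)) => // x _.
exact: cst_continuous.
Qed.

Lemma CkD {V : normedModType R} k U (f g : 'rV[R]_2 -> V) : open U ->
  Ck k U f -> Ck k U g -> Ck k U (fun x => f x + g x).
Proof.
move=> oU; elim: k f g => [|k IH] f g Cf Cg.
  by split=> // x Ux; apply: continuousD;
    [have := Ck_continuous Cf Ux|have := Ck_continuous Cg Ux].
apply: (CkSP (df := fun i x => 'D_(axis i) f x + 'D_(axis i) g x)) => //.
- by move=> x Ux; apply: continuousD;
    [have := Ck_continuous Cf Ux|have := Ck_continuous Cg Ux].
- by move=> i x Ux; apply: is_deriveD; apply: derivableP;
    [exact: Ck_derivable Cf Ux|exact: Ck_derivable Cg Ux].
- by move=> i; apply: IH; exact: Ck_derive.
Qed.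

Lemma CkM k U (f g : 'rV[R]_2 -> R^o) : open U ->
  Ck k U f -> Ck k U g -> Ck k U (fun x => f x * g x : R^o).
Proof.
move=> oU; elim: k f g => [|k IH] f g Cf Cg.
  by split=> // x Ux; apply: continuousM;
    [have := Ck_continuous Cf Ux|have := Ck_continuous Cg Ux].
apply: (CkSP (df := fun i x => f x * 'D_(axis i) g x + g x * 'D_(axis i) f x)) => //.
- by move=> x Ux; apply: continuousM;
    [have := Ck_continuous Cf Ux|have := Ck_continuous Cg Ux].
- by move=> i x Ux; apply: is_deriveM; apply: derivableP;
    [exact: Ck_derivable Cf Ux|exact: Ck_derivable Cg Ux].
- move=> i; apply: CkD => //; apply: IH; try exact: Ck_derive;
  exact: Ck_pred.
Qed.

Lemma CkZ k U (a : R) (f : 'rV[R]_2 -> R^o) : open U ->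
  Ck k U f -> Ck k U (fun x => a * f x : R^o).
Proof. by move=> oU; apply: CkM => //; exact: Ck_cst. Qed.

Lemma CkN k U (f : 'rV[R]_2 -> R^o) : open U ->
  Ck k U f -> Ck k U (fun x => - f x : R^o).
Proof.
move=> oU /(CkZ (-1) oU); apply: Ck_eq => // x _; exact: mulN1r.
Qed.

Lemma CkB k U (f g : 'rV[R]_2 -> R^o) : open U ->
  Ck k U f -> Ck k U g -> Ck k U (fun x => f x - g x : R^o).
Proof. by move=> oU ? ?; apply: CkD => //; exact: CkN. Qed.

(** A directional derivative is an ordinary derivative along the line
    t |-> t v + x, where the chain rule of one variable applies. *)
Lemma is_derive_outer (h : R -> R) (dh : R) (f : 'rV[R]_2 -> R^o) x v :
  is_derive (f x) 1 h dh -> derivable f x v ->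
  is_derive x v (h \o f : 'rV[R]_2 -> R^o) (dh * 'D_v f x).
Proof.
move=> hd fd.
have fd1 := (derivable1P _ _ _).1 fd.
have g0 : (fun t : R => f (t *: v + x)) 0 = f x by rewrite scale0r add0r.
have hd' : is_derive ((fun t : R => f (t *: v + x)) 0) 1 h dh by rewrite g0.
have := is_derive1_comp hd' (derivableP fd1).
move=> [hf1 hf2]; split.
  exact/derivable1P.
have E : forall k : 'rV[R]_2 -> R^o, 'D_v k x = 'D_1 (fun t : R => k (t *: v + x)) 0.
  move=> k; rewrite /derive.
  suff -> : (fun t : R => t^-1 *: ((k \o shift x) (t *: v) - k x)) =
    (fun t => t^-1 *: (((fun t => k (t *: v + x)) \o shift 0) t%:A -
      k (0 *: v + x))) by [].
  by apply/funext => t /=; rewrite addr0 scale0r add0r [_%:A]mulr1.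
by rewrite E [X in _ * X]E -hf2.
Qed.

(** The induction closes because the derivative of 1/f is a polynomial in 1/f
    and the derivative of f.  The square root and the logarithm below follow
    the same scheme, their derivatives being built from inverses. *)
Lemma CkV k U (f : 'rV[R]_2 -> R^o) : open U -> (forall x, U x -> f x != 0) ->
  Ck k U f -> Ck k U (fun x => (f x)^-1 : R^o).
Proof.
move=> oU f0.
have fc l : Ck l U f ->
    forall x, U x -> {for x, continuous (fun x => (f x)^-1 : R^o)}.
  move=> Cf x Ux; have fx := Ck_continuous Cf Ux.
  by apply: continuous_comp; [exact: fx|apply: inv_continuous; exact: f0].
elim: k => [|k IH] Cf; first by split => //; exact: fc Cf.
apply: (CkSP (df := fun i x => - ((f x)^-1 * (f x)^-1) * 'D_(axis i) f x)) => //.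
- exact: fc Cf.
- move=> i x Ux; have fx0 := f0 x Ux.
  apply: DeriveDef; first by apply: derivableV => //; exact: Ck_derivable Cf Ux.
  rewrite deriveV//; last exact: Ck_derivable Cf Ux.
  by rewrite -exprVn expr2.
- move=> i; apply: CkM => //; last exact: Ck_derive.
  by apply: CkN => //; apply: CkM => //; apply: IH; exact: Ck_pred.
Qed.

Lemma Ck_sqrt k U (f : 'rV[R]_2 -> R^o) : open U -> (forall x, U x -> 0 < f x) ->
  Ck k U f -> Ck k U (fun x => Num.sqrt (f x) : R^o).
Proof.
move=> oU f0.
have fc l : Ck l U f ->
    forall x, U x -> {for x, continuous (fun x => Num.sqrt (f x) : R^o)}.
  move=> Cf x Ux; have fx := Ck_continuous Cf Ux.
  by apply: (@continuous_comp _ _ _ f (Num.sqrt : R -> R)); [exact: fx|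
    exact: sqrt_continuous].
elim: k => [|k IH] Cf; first by split => //; exact: fc Cf.
apply: (CkSP (df := fun i x => (2 * Num.sqrt (f x))^-1 * 'D_(axis i) f x)) => //.
- exact: fc Cf.
- move=> i x Ux; apply: (is_derive_outer (h := Num.sqrt)).
    exact: is_derive1_sqrt (f0 x Ux).
  exact: Ck_derivable Cf Ux.
- move=> i; apply: CkM => //; last exact: Ck_derive.
  apply: CkV => //.
    by move=> x Ux; rewrite mulf_neq0// gt_eqF// sqrtr_gt0 f0.
  by apply: CkZ => //; apply: IH; exact: Ck_pred.
Qed.

Lemma Ck_ln k U (f : 'rV[R]_2 -> R^o) : open U -> (forall x, U x -> 0 < f x) ->
  Ck k U f -> Ck k U (fun x => ln (f x) : R^o).
Proof.
move=> oU f0 Cf.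
have fc x : U x -> {for x, continuous (fun x => ln (f x) : R^o)}.
  move=> Ux; have fx := Ck_continuous Cf Ux.
  by apply: (@continuous_comp _ _ _ f (@ln R)); [exact: fx|
    apply: continuous_ln; exact: f0].
case: k Cf => [|k] Cf; first by split.
apply: (CkSP (df := fun i x => (f x)^-1 * 'D_(axis i) f x)) => //.
- move=> i x Ux; apply: (is_derive_outer (h := @ln R)).
    exact: is_derive1_ln (f0 x Ux).
  exact: Ck_derivable Cf Ux.
- move=> i; apply: CkM => //; last exact: Ck_derive.
  apply: CkV => //; last exact: Ck_pred.
  by move=> x /f0/lt0r_neq0.
Qed.

Lemma derive_coord n (F : 'rV[R]_2 -> 'rV[R]_n) x v (a : 'I_n) :
  derivable F x v ->
  'D_v F x 0 a = 'D_v (fun y => F y 0 a : R^o) x.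
Proof. by move=> /derive_mx ->; rewrite mxE. Qed.

Lemma Ck_coord n k U (F : 'rV[R]_2 -> 'rV[R]_n) (a : 'I_n) : open U ->
  Ck k U F -> Ck k U (fun x => F x 0 a : R^o).
Proof.
move=> oU.
have Fc (G : 'rV[R]_2 -> 'rV[R]_n) x : U x -> {for x, continuous G} ->
    {for x, continuous (fun x => G x 0 a : R^o)}.
  move=> Ux cG; apply: (@continuous_comp _ _ _ G (fun M : 'rV[R]_n => M 0 a)) => //.
  exact: coord_continuous.
elim: k F => [|k IH] F CF.
  by split=> // x Ux; apply: Fc => //; exact: Ck_continuous CF Ux.
apply: (CkSP (df := fun i x => 'D_(axis i) F x 0 a)) => //.
- by move=> x Ux; apply: Fc => //; exact: Ck_continuous CF Ux.
- move=> i x Ux; have Fd := Ck_derivable (i := i) CF Ux.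
  rewrite derive_coord//; apply: derivableP.
  by have /derivable_mxP/(_ 0 a) := Fd.
- by move=> i; apply: IH; exact: Ck_derive.
Qed.

Lemma is_derive_proj i j x :
  is_derive x (axis i) (fun y : 'rV[R]_2 => y 0 j : R^o) ((i == j)%:R).
Proof.
have h : derivable (@id 'rV[R]_2) x (axis i) by exact: derivable_id.
apply: DeriveDef; first by have /derivable_mxP/(_ 0 j) := h.
by rewrite -(derive_coord j h) derive_id !mxE eqxx eq_sym.
Qed.

Lemma Ck_proj k U j : open U -> Ck k U (fun y : 'rV[R]_2 => y 0 j : R^o).
Proof.
move=> oU; case: k => [|k].
  by split=> // x _; exact: coord_continuous.
apply: (CkSP (V := R^o) (df := fun i x => (i == j)%:R)) => //.
- by move=> x Ux; exact: coord_continuous.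
- by move=> i x _; exact: is_derive_proj.
- by move=> i; exact: Ck_cst.
Qed.

End CkCalculus.

(** * Mean values, equality of mixed derivatives, second-order test *)

Section SecondOrder.
Context {R : realType}.
Implicit Types (U : set 'rV[R]_2) (x : 'rV[R]_2) (i j : 'I_2).

Lemma is_derive_line (f : 'rV[R]_2 -> R^o) (a v : 'rV[R]_2) (t : R) :
  derivable f (t *: v + a) v ->
  is_derive t 1 (fun s : R => f (s *: v + a) : R^o) ('D_v f (t *: v + a)).
Proof.
move=> fd.
have E : (fun h : R => h^-1 *: (((fun s : R => f (s *: v + a)) \o shift t) h%:A -
      f (t *: v + a))) =
    (fun h : R => h^-1 *: ((f \o shift (t *: v + a)) (h *: v) - f (t *: v + a))).
  by apply/funext => h /=; rewrite [_%:A]mulr1 scalerDl addrA.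
by split; rewrite /derivable /derive E.
Qed.

(** The increment s may have either sign: difference quotients approach a
    point from both sides. *)
Lemma MVT_origin (f df : R -> R) (s : R) :
  (forall t : R, `|t| <= `|s| -> is_derive t 1 f (df t)) ->
  exists2 t, `|t| <= `|s| & f s - f 0 = s * df t.
Proof.
move=> fd.
have fc : forall t, `|t| <= `|s| -> {for t, continuous f}.
  move=> t /fd[ft _]; apply: differentiable_continuous.
  exact/derivable1_diffP.
have [s0|s0] := leP 0 s.
  have ns := ger0_norm s0.
  have [|||c] := @MVT_segment R f df 0 s => //.
  - move=> x; rewrite in_itv/= => /andP[x0 xs]; apply: fd.
    by rewrite ns ger0_norm ltW.
  - apply: continuous_in_subspaceT => x; rewrite inE/= in_itv/= => /andP[x0 xs].
    by apply: fc; rewrite ns ger0_norm.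
  - rewrite in_itv/= => /andP[c0 cs] ->; exists c; first by rewrite ns ger0_norm.
    by rewrite subr0 mulrC.
have ns := ltr0_norm s0.
have [|||c] := @MVT_segment R f df s 0 => //.
- exact: ltW.
- move=> x; rewrite in_itv/= => /andP[x0 xs]; apply: fd.
  by rewrite ns ler0_norm ?ltW// ltrN2.
- apply: continuous_in_subspaceT => x; rewrite inE/= in_itv/= => /andP[x0 xs].
  by apply: fc; rewrite ns ler0_norm// lerN2.
- rewrite in_itv/= => /andP[c0 cs] fE; exists c.
    by rewrite ns ler0_norm// lerN2.
  by rewrite -opprB fE sub0r mulrN opprK mulrC.
Qed.

Lemma MVT_line (f : 'rV[R]_2 -> R^o) (a v : 'rV[R]_2) (s : R) :
  (forall t, `|t| <= `|s| -> derivable f (t *: v + a) v) ->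
  exists2 t, `|t| <= `|s| & f (s *: v + a) - f a = s * 'D_v f (t *: v + a).
Proof.
move=> fd.
have [t ts] := @MVT_origin (fun t => f (t *: v + a)) (fun t => 'D_v f (t *: v + a)) s
  (fun t ts => is_derive_line (fd t ts)).
by rewrite scale0r add0r; exists t.
Qed.

Lemma norm_axis_le1 i : `|axis i : 'rV[R]_2| <= 1.
Proof.
rewrite [leLHS]/Num.Def.normr/= mx_normrE; apply: bigmax_le => //= -[a b] _ /=.
by rewrite !mxE; case: (_ && _); rewrite ?normr1 ?normr0.
Qed.

Lemma norm_scale_axis_le i (t : R) : `|t *: (axis i : 'rV[R]_2)| <= `|t|.
Proof. by rewrite normrZ ler_piMr// norm_axis_le1. Qed.

Lemma decomp_axis (v : 'rV[R]_2) : v = v 0 0 *: axis 0 + v 0 1 *: axis 1.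
Proof.
rewrite [LHS](row_sum_delta v) big_ord_recl big_ord1.
by congr (_ + v 0 _ *: 'e_ _); apply/val_inj.
Qed.

(** The increment h v splits into a step along axis 1 followed by a step along
    axis 0.  The mean value theorem turns each step into a partial derivative
    at a nearby point, and the partial derivatives are continuous. *)
Lemma C1_is_derive U (f : 'rV[R]_2 -> R^o) x (v : 'rV[R]_2) :
  open U -> Ck 1 U f -> U x ->
  is_derive x v f (v 0 0 * 'D_(axis 0) f x + v 0 1 * 'D_(axis 1) f x).
Proof.
move=> oU Cf Ux.
set d := _ + _.
suff H : (fun h : R => h^-1 *: ((f \o shift x) (h *: v) - f x)) @ 0^' --> (d : R^o).
  by split; [apply/cvg_ex; exists d|apply: cvg_lim].
apply/cvgrPdist_le => e e0.
set m := `|v 0 0| + `|v 0 1| + 1.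
have m0 : 0 < m by rewrite ltr_wpDl// addr_ge0.
have D_near i : \forall y \near x, `|'D_(axis i) f x - 'D_(axis i) f y| <= e / m.
  have := Ck_continuous (Ck_derive i Cf) Ux.
  by move=> /cvgrPdist_le; apply; exact: divr_gt0.
have Unear : \forall y \near x, U y by exact: open_nbhs_nbhs.
have : \forall y \near x, [/\ U y, `|'D_(axis 0) f x - 'D_(axis 0) f y| <= e / m
   & `|'D_(axis 1) f x - 'D_(axis 1) f y| <= e / m].
  by move: Unear (D_near 0) (D_near 1); apply: filterS3 => y ? ? ?; split.
move=> /nbhs_ballP[r /= r0 rU].
have near_ball (s t : R) : `|s| + `|t| < r ->
    ball x r (s *: axis 0 + (t *: axis 1 + x)).
  move=> st; rewrite -ball_normE /ball_/= addrA opprD addrCA subrr addr0 normrN.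
  apply: le_lt_trans st; rewrite (le_trans (ler_normD _ _))// lerD//;
  exact: norm_scale_axis_le.
near=> h.
have h0 : h != 0 by near: h; exact: nbhs_dnbhs_neq.
have hr : `|h| * m < r.
  rewrite -ltr_pdivlMr//; near: h; apply: dnbhs0_lt; exact: divr_gt0.
have hr' : `|h * v 0 0| + `|h * v 0 1| < r.
  apply: le_lt_trans hr; rewrite !normrM -mulrDr ler_wpM2l//.
  by rewrite /m lerDl.
(* The step along axis 0, which starts where the step along axis 1 ends. *)
have [t th] : exists2 t, `|t| <= `|h * v 0 0| &
    f ((h * v 0 0) *: axis 0 + ((h * v 0 1) *: axis 1 + x)) -
      f ((h * v 0 1) *: axis 1 + x) =
    h * v 0 0 * 'D_(axis 0) f (t *: axis 0 + ((h * v 0 1) *: axis 1 + x)).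
  apply: MVT_line => t th; apply: (Ck_derivable Cf).
  have [] // := rU (t *: axis 0 + ((h * v 0 1) *: axis 1 + x)) _.
  by apply: near_ball; apply: le_lt_trans hr'; rewrite lerD2r.
have [t' th'] : exists2 t, `|t| <= `|h * v 0 1| &
    f ((h * v 0 1) *: axis 1 + x) - f x =
    h * v 0 1 * 'D_(axis 1) f (t *: axis 1 + x).
  apply: MVT_line => t' th'; apply: (Ck_derivable Cf).
  have [] // := rU (0 *: axis 0 + (t' *: axis 1 + x)) _; last by rewrite scale0r add0r.
  apply: near_ball; apply: le_lt_trans hr'.
  by rewrite normr0 add0r (le_trans th')// lerDr.
move=> E1 E2.
have [_ D0 _] := rU (t *: axis 0 + ((h * v 0 1) *: axis 1 + x))
  (near_ball _ _ (le_lt_trans (lerD th (lexx _)) hr')).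
have [|_ _ D1] := rU (0 *: axis 0 + (t' *: axis 1 + x)).
  apply: near_ball; apply: le_lt_trans hr'.
  by rewrite normr0 add0r (le_trans th')// lerDr.
move: D1; rewrite scale0r add0r => D1.
have -> : h^-1 *: ((f \o shift x) (h *: v) - f x) =
    v 0 0 * 'D_(axis 0) f (t *: axis 0 + ((h * v 0 1) *: axis 1 + x)) +
    v 0 1 * 'D_(axis 1) f (t' *: axis 1 + x).
  have hv : h *: v + x = (h * v 0 0) *: axis 0 + ((h * v 0 1) *: axis 1 + x).
    by rewrite {1}(decomp_axis v) scalerDr !scalerA addrA.
  rewrite /= hv.
  rewrite -(subrK (f ((h * v 0 1) *: axis 1 + x)) (f (_ + (_ + x)))) -addrA E1 E2.
  move: ('D_(axis 0) f _) ('D_(axis 1) f _) => p q.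
  by rewrite -!mulrA -mulrDr [_ *: _]mulKf.
rewrite /d opprD addrACA -!mulrBr.
rewrite (le_trans (ler_normD _ _))// !normrM.
apply: (@le_trans _ _ (`|v 0 0| * (e / m) + `|v 0 1| * (e / m))).
  by rewrite lerD// ler_wpM2l.
rewrite -mulrDl mulrCA ler_piMr//; first exact: ltW.
by rewrite ler_pdivrMr// mul1r /m lerDl.
Unshelve. all: by end_near. Qed.

(** The left-hand side is symmetric in i and j, up to rearrangement, whereas
    the right-hand side is not: this is the source of the equality of mixed
    derivatives. *)
Lemma second_difference U (f : 'rV[R]_2 -> R^o) x i j (h : R) :
  Ck 2 U f ->
  (forall s t, `|s| <= `|h| -> `|t| <= `|h| -> U (s *: axis j + (t *: axis i + x))) ->
  exists s t, [/\ `|s| <= `|h|, `|t| <= `|h| &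
    f (h *: axis j + (h *: axis i + x)) - f (h *: axis i + x)
     - (f (h *: axis j + x) - f x) =
    h * (h * 'D_(axis j) ('D_(axis i) f) (s *: axis j + (t *: axis i + x)))].
Proof.
move=> Cf hU.
have lex : `|h| <= `|h| by [].
have le0 : `|0 : R| <= `|h| by rewrite normr0.
have [|t th E] := @MVT_origin
  (fun t => f (t *: axis i + (h *: axis j + x)) - f (t *: axis i + x))
  (fun t => 'D_(axis i) f (t *: axis i + (h *: axis j + x)) -
            'D_(axis i) f (t *: axis i + x)) h.
  move=> t th; apply: is_deriveB; apply: is_derive_line; apply: (Ck_derivable Cf).
    by rewrite addrCA; exact: hU.
  by have := hU 0 t le0 th; rewrite scale0r add0r.
have [s sh E'] := @MVT_line ('D_(axis i) f) (t *: axis i + x) (axis j) h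
  (fun s sh => Ck_derivable (i := j) (Ck_derive i Cf) (hU s t sh th)).
exists s, t; split=> //.
rewrite -E' [in RHS](addrCA (h *: axis j)) -E !scale0r !add0r.
by rewrite (addrCA (h *: axis i)).
Qed.

Lemma schwarz U (f : 'rV[R]_2 -> R^o) x i j : open U -> Ck 2 U f -> U x ->
  'D_(axis i) ('D_(axis j) f) x = 'D_(axis j) ('D_(axis i) f) x.
Proof.
move=> oU Cf Ux; apply/eqP; rewrite -subr_eq0 -normr_le0.
apply/ler_addgt0Pl => e e0; rewrite addr0.
have near_D a b : \forall y \near x,
    `|'D_(axis a) ('D_(axis b) f) x - 'D_(axis a) ('D_(axis b) f) y| <= e / 2.
  have := Ck_continuous (Ck_derive a (Ck_derive b Cf)) Ux.
  by move=> /cvgrPdist_le; apply; exact: divr_gt0.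
have Unear : \forall y \near x, U y by exact: open_nbhs_nbhs.
have : \forall y \near x, [/\ U y,
    `|'D_(axis i) ('D_(axis j) f) x - 'D_(axis i) ('D_(axis j) f) y| <= e / 2
  & `|'D_(axis j) ('D_(axis i) f) x - 'D_(axis j) ('D_(axis i) f) y| <= e / 2].
  by move: Unear (near_D i j) (near_D j i); apply: filterS3 => y ? ? ?; split.
move=> /nbhs_ballP[r /= r0 rU].
set h := r / 3.
have h0 : 0 < h by exact: divr_gt0.
have nh : `|h| = h by rewrite gtr0_norm.
have near_ball a b (s t : R) : `|s| <= `|h| -> `|t| <= `|h| ->
    ball x r (s *: axis a + (t *: axis b + x)).
  rewrite nh => sh th.
  rewrite -ball_normE /ball_/= addrA opprD addrCA subrr addr0 normrN.
  rewrite (le_lt_trans (ler_normD _ _))//.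
  apply: (@le_lt_trans _ _ (h + h)); last by rewrite /h; lra.
  by rewrite lerD// (le_trans (norm_scale_axis_le _ _)).
have [s [t [sh th E]]] := @second_difference U f x i j h Cf
  (fun s t sh th => let: And3 H _ _ := rU _ (near_ball j i s t sh th) in H).
have [s' [t' [sh' th' E']]] := @second_difference U f x j i h Cf
  (fun s t sh th => let: And3 H _ _ := rU _ (near_ball i j s t sh th) in H).
have [_ _ D1] := rU _ (near_ball j i s t sh th).
have [_ D2 _] := rU _ (near_ball i j s' t' sh' th').
have eqD : 'D_(axis j) ('D_(axis i) f) (s *: axis j + (t *: axis i + x)) =
   'D_(axis i) ('D_(axis j) f) (s' *: axis i + (t' *: axis j + x)).
  have hn0 : h != 0 by rewrite gt_eqF.
  apply/(mulfI hn0)/(mulfI hn0).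
  apply: etrans (esym E) _; apply: etrans E'.
  rewrite (addrCA (h *: axis j)).
  by rewrite !opprB addrACA [RHS]addrACA; congr (_ + _); exact: addrC.
rewrite -(subrKA ('D_(axis i) ('D_(axis j) f) (s' *: axis i + (t' *: axis j + x)))).
apply: (le_trans (ler_normD _ _)); rewrite (splitr e).
by apply: lerD; [exact: D2|rewrite -eqD distrC; exact: D1].
Unshelve. all: by end_near. Qed.

(** If c were positive, df would be positive just to the right of 0, and f
    would increase there. *)
Lemma second_derivative_at_max (f df : R -> R) (c r : R) : 0 < r ->
  (forall t : R, `|t| < r -> is_derive t 1 f (df t)) -> is_derive (0 : R) 1 df c ->
  (forall t, `|t| < r -> f t <= f 0) -> df 0 = 0 /\ c <= 0.
Proof.
move=> r0 fd [dfd dfE] fmax.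
have df0 : df 0 = 0.
  have itvr t : t \in `](- r), r[ -> `|t| < r.
    by rewrite in_itv/= ltr_norml.
  have [_ H] : is_derive (0 : R) 1 f 0.
    apply: (@derive1_at_max R f (- r) r 0).
    - by rewrite ge0_cp// ltW.
    - by move=> t /itvr/fd[].
    - by rewrite in_itv/= oppr_lt0 r0.
    - by move=> t /itvr/fmax.
  have [|_ <-] := fd 0; first by rewrite normr0.
  exact: H.
split=> //; rewrite leNgt; apply/negP => c0.
have : (fun h : R => h^-1 *: ((df \o shift 0) h%:A - df 0)) @ 0^' --> (c : R^o).
  by rewrite -dfE; exact: dfd.
move=> /cvgrPdist_lt/(_ c c0)[e /= e0 He].
set s := Num.min (e / 2) (r / 2).
have s0 : 0 < s by rewrite lt_min !divr_gt0.
have se : s < e by rewrite (@le_lt_trans _ _ (e / 2))// ?ge_min ?lexx//; lra.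
have sr : s < r by rewrite (@le_lt_trans _ _ (r / 2))// ?ge_min ?lexx ?orbT//; lra.
have dfpos t : 0 < t -> t < e -> 0 < df t.
  move=> t0 te; have := He t; rewrite /= sub0r normrN gtr0_norm// => /(_ te).
  rewrite gt_eqF// => /(_ isT).
  rewrite addr0 df0 subr0 [_%:A]mulr1 [_ *: _]/(_ * _) ltr_norml => /andP[_ H].
  move: H; rewrite ltrBlDr ltrDl.
  by rewrite pmulr_rgt0// invr_gt0.
have [||c1 ] := @MVT R f df 0 s s0.
- move=> t; rewrite in_itv/= => /andP[t0 ts]; apply: fd.
  by rewrite gtr0_norm// (lt_trans ts).
- apply: continuous_in_subspaceT => t; rewrite inE/= in_itv/= => /andP[t0 ts].
  have [|ft _] := fd t; first by rewrite ger0_norm// (le_lt_trans ts).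
  by apply: differentiable_continuous; exact/derivable1_diffP.
- rewrite in_itv/= => /andP[c10 c1s] E.
  have : 0 < f s - f 0.
    by rewrite E subr0 mulr_gt0// dfpos// (lt_trans c1s).
  by rewrite subr_gt0 ltNge fmax// gtr0_norm.
Qed.

(** Second-order test along every line through the maximum. *)
Lemma C2_max U (f : 'rV[R]_2 -> R^o) x : open U -> Ck 2 U f -> U x ->
  (forall y, U y -> f y <= f x) ->
  (forall i, 'D_(axis i) f x = 0) /\
  forall v : 'rV[R]_2,
    v 0 0 * (v 0 0 * 'D_(axis 0) ('D_(axis 0) f) x +
             v 0 1 * 'D_(axis 1) ('D_(axis 0) f) x) +
    v 0 1 * (v 0 0 * 'D_(axis 0) ('D_(axis 1) f) x +
             v 0 1 * 'D_(axis 1) ('D_(axis 1) f) x) <= 0.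
Proof.
move=> oU Cf Ux fmax.
have key (v : 'rV[R]_2) :
    v 0 0 * 'D_(axis 0) f x + v 0 1 * 'D_(axis 1) f x = 0 /\
    v 0 0 * (v 0 0 * 'D_(axis 0) ('D_(axis 0) f) x +
             v 0 1 * 'D_(axis 1) ('D_(axis 0) f) x) +
    v 0 1 * (v 0 0 * 'D_(axis 0) ('D_(axis 1) f) x +
             v 0 1 * 'D_(axis 1) ('D_(axis 1) f) x) <= 0.
  have C1f : Ck 1 U f by exact: Ck_pred.
  have /nbhs_ballP[r /= r0 rU] : \forall y \near x, U y by exact: open_nbhs_nbhs.
  set m := `|v| + 1; have m0 : 0 < m by rewrite ltr_wpDl.
  have inU t : `|t| < r / m -> U (t *: v + x).
    move=> tr; apply: rU; rewrite -ball_normE /ball_/= opprD addrCA subrr addr0 normrN.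
    rewrite normrZ; move: tr; rewrite ltr_pdivlMr//; apply: le_lt_trans.
    by rewrite ler_wpM2l// /m lerDl.
  have x0 : x = 0 *: v + x by rewrite scale0r add0r.
  have lineD (g : 'rV[R]_2 -> R^o) (t : R) : Ck 1 U g -> `|t| < r / m ->
      is_derive t 1 (fun s : R => g (s *: v + x) : R^o)
        (v 0 0 * 'D_(axis 0) g (t *: v + x) + v 0 1 * 'D_(axis 1) g (t *: v + x)).
    move=> Cg tr; have [gd <-] := C1_is_derive v oU Cg (inU t tr).
    exact: is_derive_line.
  have rm0 : 0 < r / m by exact: divr_gt0.
  have nr0 : `|0 : R| < r / m by rewrite normr0.
  rewrite [in X in X /\ _]x0; rewrite [in X in _ /\ X]x0.
  apply: (@second_derivative_at_max (fun t => f (t *: v + x))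
    (fun t => v 0 0 * 'D_(axis 0) f (t *: v + x) + v 0 1 * 'D_(axis 1) f (t *: v + x))
    _ (r / m)) => //.
  - by move=> t tr; exact: lineD.
  - have D0 := lineD _ 0 (Ck_derive 0 Cf) nr0.
    have D1 := lineD _ 0 (Ck_derive 1 Cf) nr0.
    exact: is_deriveD (is_deriveZ (v 0 0) D0) (is_deriveZ (v 0 1) D1).
  - by move=> t tr; rewrite -x0; apply: fmax; exact: inU.
split; last by move=> v; have [] := key v.
move=> i; have [+ _] := key (axis i).
by rewrite !mxE; case: (i =P 0) => [->|/eqP]; last first;
  rewrite /= ?mul1r ?mul0r ?addr0 ?add0r//;
  case: i => -[|[|//]] //= ? _; rewrite mul0r add0r mul1r => <-;
  congr ('D_(axis _) _ _); apply/val_inj.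
Qed.

End SecondOrder.

(** * Second-order elliptic operators in two variables *)

(** The partial derivatives are locked so that distinct ones are told apart by
    their arguments, without unfolding the limits that define them. *)
HB.lock Definition grad {R : realType} (f : 'rV[R]_2 -> R^o) (x : 'rV[R]_2)
  (i : 'I_2) : R := 'D_(axis i) f x.
Canonical grad_unlockable := Unlockable grad.unlock.

HB.lock Definition hess {R : realType} (f : 'rV[R]_2 -> R^o) (x : 'rV[R]_2)
  (i j : 'I_2) : R := 'D_(axis i) ('D_(axis j) f) x.
Canonical hess_unlockable := Unlockable hess.unlock.

Section EllipticOperator.
Context {R : realType}.
Implicit Types (U : set 'rV[R]_2) (x : 'rV[R]_2) (i j : 'I_2)
  (a : 'I_2 -> 'I_2 -> 'rV[R]_2 -> R) (b : 'I_2 -> 'rV[R]_2 -> R)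
  (f g : 'rV[R]_2 -> R^o).

(** The carre du champ of the operator with second-order part a: it measures
    the failure of the Leibniz rule for that operator, see [diffopM]. *)
Definition carre a f g x : R :=
  \sum_i \sum_j a i j x * (grad f x i * grad g x j).

Definition diffop a b f x : R :=
  \sum_i \sum_j a i j x * hess f x i j + \sum_j b j x * grad f x j.

(** Positive definiteness of a symmetric matrix of size 2, by its leading
    minors. *)
Definition elliptic a x : Prop :=
  [/\ a 0 1 x = a 1 0 x, 0 < a 0 0 x & 0 < a 0 0 x * a 1 1 x - a 0 1 x * a 0 1 x].

Lemma sum_ord2 (F : 'I_2 -> R) : \sum_i F i = F 0 + F 1.
Proof. by rewrite big_ord_recl big_ord1; congr (_ + F _); apply/val_inj. Qed.

Lemma sum2_ord2 (F : 'I_2 -> 'I_2 -> R) :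
  \sum_i \sum_j F i j = F 0 0 + F 0 1 + (F 1 0 + F 1 1).
Proof. by rewrite !sum_ord2. Qed.

Lemma diffopE a b f x : diffop a b f x =
  a 0 0 x * hess f x 0 0 + a 0 1 x * hess f x 0 1 +
  (a 1 0 x * hess f x 1 0 + a 1 1 x * hess f x 1 1) +
  (b 0 x * grad f x 0 + b 1 x * grad f x 1).
Proof. exact: congr2 (sum2_ord2 _) (sum_ord2 _). Qed.

Lemma carreE a f g x : carre a f g x =
  a 0 0 x * (grad f x 0 * grad g x 0) + a 0 1 x * (grad f x 0 * grad g x 1) +
  (a 1 0 x * (grad f x 1 * grad g x 0) + a 1 1 x * (grad f x 1 * grad g x 1)).
Proof. exact: sum2_ord2. Qed.

Lemma derive_eq_on {V : normedModType R} U (f g : 'rV[R]_2 -> V) x v :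
  open U -> U x -> (forall y, U y -> f y = g y) -> 'D_v f x = 'D_v g x.
Proof. by move=> oU Ux fg; apply: near_eq_derive; exact: open_near_eq oU Ux fg. Qed.

Lemma gradE f x i : grad f x i = 'D_(axis i) f x.
Proof. by rewrite unlock. Qed.

Lemma hessE f x i j : hess f x i j = grad (fun y => grad f y j) x i.
Proof.
by rewrite !unlock.
Qed.

Lemma grad_eq U f g i x : open U -> U x -> (forall y, U y -> f y = g y) ->
  grad f x i = grad g x i.
Proof. by move=> oU Ux fg; rewrite !gradE; exact: derive_eq_on fg. Qed.

Lemma hess_eq_grad U f g i j x : open U -> U x ->
  (forall y, U y -> grad f y j = g y) -> hess f x i j = grad g x i.
Proof. by move=> oU Ux fg; rewrite hessE; exact: grad_eq fg. Qed.

Lemma Ck_grad k U f i : Ck k.+1 U f -> Ck k U (fun x => grad f x i : R^o).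
Proof.
move=> /(Ck_derive i); congr Ck; apply/funext => x; by rewrite gradE.
Qed.

Lemma Ck_hess k U f i j : Ck k.+2 U f -> Ck k U (fun x => hess f x i j : R^o).
Proof.
move=> /(Ck_grad j)/(Ck_grad i); congr Ck; apply/funext => x; by rewrite hessE.
Qed.

Lemma CkP k U f i x : Ck k.+1 U f -> U x -> is_derive x (axis i) f (grad f x i).
Proof.
by move=> Cf Ux; rewrite gradE; apply: derivableP; exact: Ck_derivable Cf Ux.
Qed.

Lemma grad_const i x (c : R) : grad (fun=> c) x i = 0.
Proof. by rewrite gradE; exact: derive_cst. Qed.

Lemma hess_const i j x (c : R) : hess (fun=> c) x i j = 0.
Proof.
by rewrite (hess_eq_grad (U := setT) (g := fun=> 0) i (j := j))//; [exact: grad_const|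
  exact: openT|move=> y _; exact: grad_const].
Qed.

Lemma gradD U f g i x : Ck 1 U f -> Ck 1 U g -> U x ->
  grad (fun y => f y + g y) x i = grad f x i + grad g x i.
Proof.
move=> Cf Cg Ux.
by rewrite gradE; have [_ H] := is_deriveD (CkP i Cf Ux) (CkP i Cg Ux).
Qed.

Lemma gradM U f g i x : Ck 1 U f -> Ck 1 U g -> U x ->
  grad (fun y => f y * g y) x i = f x * grad g x i + g x * grad f x i.
Proof.
move=> Cf Cg Ux.
by rewrite gradE; have [_ H] := is_deriveM (CkP i Cf Ux) (CkP i Cg Ux).
Qed.

Lemma hessD U f g i j x : open U -> Ck 2 U f -> Ck 2 U g -> U x ->
  hess (fun y => f y + g y) x i j = hess f x i j + hess g x i j.
Proof.
move=> oU Cf Cg Ux.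
rewrite (hess_eq_grad (g := fun y => grad f y j + grad g y j) i oU Ux).
  by rewrite (gradD i (Ck_grad j Cf) (Ck_grad j Cg) Ux) -!hessE.
by move=> y Uy; exact: gradD (Ck_pred Cf) (Ck_pred Cg) Uy.
Qed.

Lemma hessM U f g i j x : open U -> Ck 2 U f -> Ck 2 U g -> U x ->
  hess (fun y => f y * g y) x i j =
  f x * hess g x i j + grad f x i * grad g x j +
  (g x * hess f x i j + grad g x i * grad f x j).
Proof.
move=> oU Cf Cg Ux.
rewrite (hess_eq_grad (g := fun y => f y * grad g y j + g y * grad f y j) i oU Ux);
  last by move=> y Uy; exact: gradM (Ck_pred Cf) (Ck_pred Cg) Uy.
have C1f := Ck_pred Cf; have C1g := Ck_pred Cg.
have CDf := Ck_grad j Cf; have CDg := Ck_grad j Cg.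
rewrite (gradD i (CkM oU C1f CDg) (CkM oU C1g CDf) Ux).
rewrite (gradM i C1f CDg Ux) (gradM i C1g CDf Ux).
rewrite -!hessE; ring.
Qed.

Lemma diffopD a b U f g x : open U -> Ck 2 U f -> Ck 2 U g -> U x ->
  diffop a b (fun y => f y + g y) x = diffop a b f x + diffop a b g x.
Proof.
move=> oU Cf Cg Ux; rewrite !diffopE.
rewrite !(hessD _ _ oU Cf Cg Ux) !(gradD _ (Ck_pred Cf) (Ck_pred Cg) Ux).
ring.
Qed.

Lemma diffopM a b U f g x : a 0 1 x = a 1 0 x ->
  open U -> Ck 2 U f -> Ck 2 U g -> U x ->
  diffop a b (fun y => f y * g y) x =
  f x * diffop a b g x + g x * diffop a b f x + 2 * carre a f g x.
Proof.
move=> a01 oU Cf Cg Ux; rewrite !diffopE carreE.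
rewrite !(hessM _ _ oU Cf Cg Ux) !(gradM _ (Ck_pred Cf) (Ck_pred Cg) Ux).
rewrite a01; ring.
Qed.

Lemma diffopZ a b U (c : R) f x : open U -> Ck 2 U f -> U x ->
  diffop a b (fun y => c * f y) x = c * diffop a b f x.
Proof.
move=> oU Cf Ux; have Cc := Ck_cst 2 (V := R^o) c oU.
rewrite !diffopE !(hessM _ _ oU Cc Cf Ux) !(gradM _ (Ck_pred Cc) (Ck_pred Cf) Ux).
rewrite !hess_const !grad_const; ring.
Qed.

Lemma gradV U f i x : Ck 1 U f -> f x != 0 -> U x ->
  grad (fun y => (f y)^-1) x i = - ((f x)^-1 ^+ 2 * grad f x i).
Proof.
move=> Cf f0 Ux; rewrite !gradE (@deriveV _ _ f)//; last exact: Ck_derivable Cf Ux.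
by rewrite exprVn; exact: mulNr.
Qed.

Lemma grad_ln U f i x : Ck 1 U f -> 0 < f x -> U x ->
  grad (fun y => ln (f y)) x i = (f x)^-1 * grad f x i.
Proof.
move=> Cf f0 Ux.
have [_ H] := is_derive_outer (is_derive1_ln f0) (Ck_derivable (i := i) Cf Ux).
by rewrite !gradE.
Qed.

Lemma diffop_ln a b U f x : a 0 1 x = a 1 0 x ->
  open U -> Ck 2 U f -> (forall y, U y -> 0 < f y) -> U x ->
  diffop a b (fun y => ln (f y)) x =
  (f x)^-1 * diffop a b f x - (f x)^-1 ^+ 2 * carre a f f x.
Proof.
move=> a01 oU Cf f0 Ux.
have f_neq0 y : U y -> f y != 0 by move=> /f0/lt0r_neq0.
have CV : Ck 2 U (fun y => (f y)^-1 : R^o) by exact: CkV.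
have H i j : hess (fun y => ln (f y)) x i j = (f x)^-1 * hess f x i j
    - (f x)^-1 ^+ 2 * (grad f x i * grad f x j).
  rewrite (hess_eq_grad (g := fun y => (f y)^-1 * grad f y j : R^o) i oU Ux);
    last by move=> y Uy; exact: grad_ln (Ck_pred Cf) (f0 y Uy) Uy.
  rewrite (gradM i (Ck_pred CV) (Ck_grad j Cf) Ux).
  rewrite (gradV i (Ck_pred Cf) (f_neq0 x Ux) Ux).
  rewrite -hessE; ring.
rewrite !diffopE carreE !H !(grad_ln _ (Ck_pred Cf) (f0 x Ux) Ux); ring.
Qed.

Lemma carreM a U f g h x : Ck 1 U f -> Ck 1 U g -> U x ->
  carre a (fun y => f y * g y) h x = f x * carre a g h x + g x * carre a f h x.
Proof. by move=> Cf Cg Ux; rewrite !carreE !(gradM _ Cf Cg Ux); ring. Qed.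

Lemma carreD a U f g h x : Ck 1 U f -> Ck 1 U g -> U x ->
  carre a (fun y => f y + g y) h x = carre a f h x + carre a g h x.
Proof. by move=> Cf Cg Ux; rewrite !carreE !(gradD _ Cf Cg Ux); ring. Qed.

Lemma carreC a f g x : a 0 1 x = a 1 0 x -> carre a f g x = carre a g f x.
Proof. by move=> a01; rewrite !carreE a01; ring. Qed.

(** Completing the square in the quadratic form multiplied by its first
    coefficient. *)
Lemma elliptic_pos a x (u v : R) : elliptic a x -> (u, v) != (0, 0) ->
  0 < a 0 0 x * (u * u) + 2 * a 0 1 x * (u * v) + a 1 1 x * (v * v).
Proof.
case=> _; move: (a 0 0 x) (a 0 1 x) (a 1 1 x) => p q r p0 D0 uv.
rewrite -(pmulr_rgt0 _ p0).
have -> : p * (p * (u * u) + 2 * q * (u * v) + r * (v * v)) =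
  (p * u + q * v) ^+ 2 + (p * r - q * q) * v ^+ 2 by ring.
have [v0|v0] := eqVneq v 0; last first.
  by rewrite ltr_wpDl ?sqr_ge0// mulr_gt0// exprn_even_gt0.
rewrite v0 mulr0 addr0 expr0n/= mulr0 addr0 exprn_even_gt0//=.
rewrite mulf_neq0// ?(gt_eqF p0)//.
by move: uv; rewrite v0 xpair_eqE eqxx andbT.
Qed.

(** At a maximum the first-order part vanishes.  Completing the square writes
    the second-order part as a combination, with nonnegative coefficients, of
    the second derivatives along (a 0 0, a 0 1) and along axis 1, which are
    nonpositive. *)
Lemma diffop_max a b U f x : open U -> Ck 2 U f -> U x ->
  (forall y, U y -> f y <= f x) -> elliptic a x -> diffop a b f x <= 0.
Proof.
move=> oU Cf Ux fmax [a01 p0 D0].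
have [Df DDf] := C2_max oU Cf Ux fmax.
have G0 i : grad f x i = 0 by rewrite gradE; exact: Df.
rewrite diffopE !G0 !mulr0 !addr0 -a01.
have H (v : 'rV[R]_2) :
    v 0 0 * (v 0 0 * hess f x 0 0 + v 0 1 * hess f x 1 0) +
    v 0 1 * (v 0 0 * hess f x 0 1 + v 0 1 * hess f x 1 1) <= 0.
  by rewrite !hess.unlock; exact: DDf.
have := H (\row_j a 0 j x); have := H (axis 1); rewrite !mxE /=.
move: p0 D0; move: (a 0 0 x) (a 0 1 x) (a 1 1 x) => p q r p0 D0.
rewrite !(mul1r, mul0r, add0r, mulr0).
move: (hess f x 0 0) (hess f x 0 1) (hess f x 1 0) (hess f x 1 1).
move=> A B C D D_le Hle.
rewrite -(pmulr_rle0 _ p0).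
have -> : p * (p * A + q * B + (q * C + r * D)) =
  p * (p * A + q * C) + q * (p * B + q * D) + (p * r - q * q) * D by ring.
rewrite -[leRHS]addr0 lerD// mulr_ge0_le0//; exact: ltW.
Qed.

Lemma diffop_continuous a b U f x : open U -> Ck 2 U f -> U x ->
  (forall i j, {for x, continuous (a i j)}) ->
  (forall i, {for x, continuous (b i)}) ->
  {for x, continuous (diffop a b f)}.
Proof.
move=> oU Cf Ux ac bc.
have D1c j : {for x, continuous (fun y => grad f y j : R^o)}.
  exact: Ck_continuous (Ck_grad j Cf) Ux.
have D2c i j : {for x, continuous (fun y => hess f y i j : R^o)}.
  exact: Ck_continuous (Ck_hess i j Cf) Ux.
have aD2c i j : {for x, continuous (fun y => a i j y * hess f y i j : R^o)}.
  by apply: continuousM; [exact: ac|exact: D2c].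
have bD1c j : {for x, continuous (fun y => b j y * grad f y j : R^o)}.
  by apply: continuousM; [exact: bc|exact: D1c].
apply: (near_eq_continuous (f := fun y =>
  a 0 0 y * hess f y 0 0 + a 0 1 y * hess f y 0 1 +
  (a 1 0 y * hess f y 1 0 + a 1 1 y * hess f y 1 1) +
  (b 0 y * grad f y 0 + b 1 y * grad f y 1) : R^o)).
  by apply: filterE => y; rewrite diffopE.
apply: continuousD; apply: continuousD; first apply: continuousD.
all: by [exact: aD2c|apply: continuousD; exact: aD2c|exact: bD1c].
Qed.

End EllipticOperator.

(** * Maxima of functions continuous on a set *)

Section Extrema.
Context {R : realType} {T : topologicalType}.
Implicit Types (K : set T) (h : T -> R^o).

Lemma continuous_for_within K h :
  (forall p, K p -> {for p, continuous h}) -> {within K, continuous h}.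
Proof. by move=> hc; apply: continuous_in_subspaceT => p; rewrite inE; exact: hc. Qed.

Lemma exists_max_on K h :
  K !=set0 -> compact K -> {within K, continuous h} ->
  exists2 c, K c & forall p, K p -> h p <= h c.
Proof.
move=> K0 cK hc; have [c] := compact_EVT_max K0 cK hc.
by rewrite inE => Kc cmax; exists c => // p Kp; apply: cmax; exact: mem_set.
Qed.

(** For c the maximum of h on K, this is the set of points where the maximum
    is attained. *)
Lemma closed_superlevel K h (c : R) : closed K -> {within K, continuous h} ->
  closed (K `&` [set p | c <= h p]).
Proof.
move=> clK hc p clp.
have Kp : K p by apply: clK; apply: closure_subset clp => q [].
split=> //=; rewrite leNgt; apply/negP => hlt.
have /cvgr_lt/(_ c hlt) near_lt := (subspace_continuousP _ _).1 hc p Kp.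
by have [q [[Kq /= +] qlt]] := clp _ near_lt; rewrite leNgt qlt.
Qed.

End Extrema.

(** * The strong maximum principle of Hopf *)

Section Hopf.
Context {R : realType}.
Implicit Types (U : set 'rV[R]_2) (x y z p : 'rV[R]_2) (i j : 'I_2)
  (a : 'I_2 -> 'I_2 -> 'rV[R]_2 -> R) (b : 'I_2 -> 'rV[R]_2 -> R)
  (f g : 'rV[R]_2 -> R^o).

(** The square of the Euclidean distance, a polynomial, where the norm of row
    vectors is the supremum norm: the barrier of Hopf's lemma has to be
    smooth. *)
Definition sqdist y p : R :=
  (p 0 0 - y 0 0) * (p 0 0 - y 0 0) + (p 0 1 - y 0 1) * (p 0 1 - y 0 1).

Lemma Ck_sub_const k (c : R) j :
  Ck k setT (fun p => p 0 j - c : R^o).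
Proof.
apply: CkB; [exact: openT|exact: Ck_proj openT|exact: Ck_cst openT].
Qed.

Lemma Ck_sqdist k y : Ck k setT (sqdist y : 'rV[R]_2 -> R^o).
Proof. by apply: CkD; try exact: openT; apply: CkM; try exact: openT;
  exact: Ck_sub_const.
Qed.

Lemma grad_sqdist y p i : grad (sqdist y) p i = 2 * (p 0 i - y 0 i).
Proof.
have D j : grad (fun p => p 0 j - y 0 j) p i = (i == j)%:R.
  rewrite gradE.
  have [_ ->] := is_deriveB (is_derive_proj i j p) (is_derive_cst (y 0 j : R^o) p (axis i)).
  by rewrite subr0.
have C j := Ck_sub_const 1 (y 0 j) j.
rewrite (gradD i (CkM openT (C 0) (C 0)) (CkM openT (C 1) (C 1)) (x := p))//.
rewrite (gradM i (C 0) (C 0) (x := p))// (gradM i (C 1) (C 1) (x := p))// !D.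
have [->|i1] := eqVneq i 0; first by rewrite /=; ring.
have -> : i = 1 by move: i1; case: (i) => -[|[|]]//= ? _; apply/val_inj.
by rewrite eqxx /=; ring.
Qed.

Lemma sqdist_ge0 y p : 0 <= sqdist y p.
Proof. by rewrite addr_ge0// -expr2 sqr_ge0. Qed.

Lemma sqdist0 y : sqdist y y = 0.
Proof. by rewrite /sqdist !subrr; ring. Qed.

Lemma rV2_eqP p y : p 0 0 = y 0 0 -> p 0 1 = y 0 1 -> p = y.
Proof.
move=> h0 h1; apply/rowP => i.
by case: i => -[|[|//]] h; [rewrite (_ : Ordinal h = 0)|rewrite (_ : Ordinal h = 1)];
  rewrite //; apply/val_inj.
Qed.

Lemma sqdist_gt0 y p : p != y -> 0 < sqdist y p.
Proof.
move=> py; rewrite lt_neqAle sqdist_ge0 andbT eq_sym paddr_eq0 -?expr2 ?sqr_ge0//.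
rewrite !sqrf_eq0 !subr_eq0; apply: contra py => /andP[/eqP h0 /eqP h1].
by apply/eqP; exact: rV2_eqP.
Qed.

Lemma norm_rV_le n (p : 'rV[R]_n) (r : R) : 0 <= r ->
  (forall k : 'I_n, `|p 0 k| <= r) -> `|p| <= r.
Proof.
move=> r0 h; rewrite [leLHS]/Num.Def.normr/= mx_normrE.
by apply: bigmax_le => //= -[k i] _ /=; rewrite (ord1 k).
Qed.

Lemma norm_coord_le p i : `|p 0 i| <= `|p|.
Proof.
rewrite [leRHS]/Num.Def.normr/= mx_normrE.
exact: (le_bigmax _ (fun k : 'I_1 * 'I_2 => `|p k.1 k.2|) (0, i)).
Qed.

Lemma sqdist_le y p (r : R) : `|p - y| <= r -> sqdist y p <= r ^+ 2 *+ 2.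
Proof.
move=> pr; have r0 : 0 <= r by exact: le_trans pr.
have h i : (p 0 i - y 0 i) * (p 0 i - y 0 i) <= r ^+ 2.
  rewrite -expr2 -real_normK ?num_real// lerXn2r ?nnegrE//.
  by apply: le_trans pr; have := norm_coord_le (p - y) i; rewrite !mxE.
by rewrite mulr2n lerD.
Qed.

Lemma norm_le_sqdist y p (r : R) : 0 <= r -> sqdist y p <= r ^+ 2 -> `|p - y| <= r.
Proof.
move=> r0 h; apply: norm_rV_le => // i; rewrite !mxE.
rewrite -(ler_pXn2r (n := 2)) ?nnegrE// real_normK ?num_real//.
apply: le_trans h; rewrite /sqdist -!expr2; case: i => -[|[|//]] h.
  by rewrite (_ : Ordinal h = 0) ?lerDl ?sqr_ge0//; apply/val_inj.
by rewrite (_ : Ordinal h = 1) ?lerDr ?sqr_ge0//; apply/val_inj.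
Qed.

Lemma compact_norm_ball n (z : 'rV[R]_n) (r : R) : compact [set p | `|p - z| <= r].
Proof.
apply: bounded_closed_compact.
  exists (`|z| + r); split; first exact: num_real.
  move=> M hM p /= pr; rewrite (le_trans _ (ltW hM))//.
  by rewrite -[p](subrK z) addrC (le_trans (ler_normD _ _))// lerD2l.
have -> : [set p | `|p - z| <= r] = closed_ball_ Num.norm z r.
  by apply/seteqP; split=> p; rewrite /closed_ball_/= distrC.
exact: closed_closed_ball_.
Qed.

(** A subharmonic f cannot attain its maximum at a point z of the boundary of a
    disc centred at y inside of which f is smaller, when z is interior to the
    domain of f.

    Let s be |z - y|^2 - |p - y|^2 - |p - z|^2, as a function of p.  It vanishes
    at z with nonzero gradient, and apart from z the set where s is nonnegative
    lies in the open disc, hence f is smaller than f z there.  For A large,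
    v = s + A s^2 has the sign of s near z and is strictly subharmonic near z,
    because the square contributes 2 A a(grad s, grad s).  On a small closed
    square around z, the function f + d v then has its maximum in the interior
    if d is small: on the part of the boundary where s is nonnegative, f stays
    away from f z by compactness, and where s is negative so is v.  At that
    interior maximum the operator is positive, which [diffop_max] forbids. *)
Lemma hopf_touching a b U f z y : open U -> Ck 2 U f ->
  (forall p, U p -> elliptic a p) ->
  (forall p i j, U p -> {for p, continuous (a i j)}) ->
  (forall p i, U p -> {for p, continuous (b i)}) ->
  (forall p, U p -> 0 <= diffop a b f p) ->
  U z -> z != y -> (forall p, U p -> f p <= f z) ->
  (forall p, U p -> sqdist y p < sqdist y z -> f p < f z) -> False.
Proof.
move=> oU Cf ell ac bc Lf Uz zy fmax flt.
pose s p : R^o := sqdist y z + - 1 * (sqdist y p + sqdist z p).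
have CkU k g : Ck k setT g -> Ck k U g by exact: Ck_subset.
have Csum : Ck 2 setT (fun p => sqdist y p + sqdist z p : R^o).
  by apply: CkD; [exact: openT|exact: Ck_sqdist|exact: Ck_sqdist].
have Cs : Ck 2 U s.
  apply: CkU; apply: CkD; [exact: openT|exact: (Ck_cst _ _ openT)|].
  exact: (CkZ (-1) openT).
have sz : s z = 0 by rewrite /s sqdist0; ring.
have gs i : grad s z i = -2 * (z 0 i - y 0 i).
  have C1 := Ck_pred Csum.
  rewrite (gradD i (Ck_cst 1 (sqdist y z : R^o) openT) (CkZ (-1) openT C1) (x := z))//.
  rewrite (gradM i (Ck_cst 1 (-1 : R^o) openT) C1 (x := z))// !grad_const.
  rewrite (gradD i (Ck_sqdist 1 y) (Ck_sqdist 1 z) (x := z))// !grad_sqdist.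
  ring.
have Gs : 0 < carre a s s z.
  have [a01 _ _] := ell z Uz.
  have := @elliptic_pos _ a z (grad s z 0) (grad s z 1) (ell z Uz).
  rewrite xpair_eqE !gs !mulf_eq0 oppr_eq0 pnatr_eq0/= !subr_eq0.
  have -> : ~~ ((z 0 0 == y 0 0) && (z 0 1 == y 0 1)).
    by apply: contra zy => /andP[/eqP h0 /eqP h1]; apply/eqP; exact: rV2_eqP.
  move=> /(_ isT); rewrite carreE !gs -a01 => h.
  by apply: (lt_le_trans h); rewrite le_eqVlt; apply/orP; left; apply/eqP; ring.
(* At z the operator gives L s + 2 A a(grad s, grad s), as s vanishes there. *)
pose A := (`|diffop a b s z| + 1) / carre a s s z.
have A0 : 0 < A by rewrite divr_gt0// ltr_wpDl.
pose v p : R^o := s p + A * (s p * s p).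
have Css := CkM oU Cs Cs.
have Cv : Ck 2 U v := CkD oU Cs (CkZ A oU Css).
have Lv : 0 < diffop a b v z.
  have [a01 _ _] := ell z Uz.
  rewrite (diffopD a b oU Cs (CkZ A oU Css) Uz) (diffopZ a b A oU Css Uz).
  rewrite (diffopM b a01 oU Cs Cs Uz) sz !mul0r !add0r.
  rewrite /A mulrCA -mulrA mulVf ?gt_eqF// mulr1.
  have := ler_norm (- diffop a b s z); rewrite normrN.
  move: (diffop a b s z) => t; move: `|t| (normr_ge0 t) => u; lra.
have near_pos : \forall p \near z, [/\ U p, 0 < diffop a b v p & 0 < 1 + A * s p].
  have n1 : \near z, U z by exact: open_nbhs_nbhs.
  have n2 : \forall p \near z, 0 < diffop a b v p.
    have := diffop_continuous oU Cv Uz (fun i j => ac z i j Uz) (fun i => bc z i Uz).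
    by move/cvgr_gt; exact.
  have n3 : \forall p \near z, 0 < 1 + A * s p.
    have C3 : Ck 2 U (fun p => 1 + A * s p : R^o).
      exact: CkD oU (Ck_cst _ _ oU) (CkZ A oU Cs).
    by have /cvgr_gt := Ck_continuous C3 Uz; apply; rewrite sz mulr0 addr0.
  by move: n1 n2 n3; apply: filterS3 => p ? ? ?; split.
have [e /= e0 eU] := (nbhs_ballP _ _).1 near_pos.
pose r := e / 2; have r0 : 0 < r by exact: divr_gt0.
have inball p : `|p - z| <= r -> [/\ U p, 0 < diffop a b v p & 0 < 1 + A * s p].
  move=> pr; apply: eU; rewrite -ball_normE /ball_/= distrC.
  by rewrite (le_lt_trans pr)// /r; lra.
pose K := [set p | `|p - z| <= r].
pose K' := [set p | `|p - z| <= r] `&` ([set p | `|p - z| = r] `&` [set p | 0 <= s p]).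
have cK : compact K by exact: compact_norm_ball.
have sc p : {for p, continuous s}.
  have : Ck 2 setT s.
    apply: CkD; [exact: openT|exact: (Ck_cst _ _ openT)|].
    exact: (CkZ (-1) openT).
  by move/Ck_continuous; exact.
have cK' : compact K'.
  apply: compact_closedI => //; apply: closedI.
    apply: (@closed_comp _ _ (fun p => `|p - z|) [set r]); last exact: closed_eq.
    move=> p _; apply: (@continuous_comp _ _ _ (fun p => p - z) Num.norm).
      by apply: continuousB; [exact: cvg_id|exact: cst_continuous].
    exact: norm_continuous.
  apply: (@closed_comp _ _ s [set x | 0 <= x]); last exact: closed_ge.
  by move=> p _; exact: sc.
have K'lt p : K' p -> f p < f z.
  move=> [pK [/= pr sp]]; have [Up _ _] := inball p pK.
  apply: flt => //; have : 0 < sqdist z p.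
    by apply: sqdist_gt0; apply: contraPneq r0 => pz; rewrite -pr pz subrr normr0 ltxx.
  by move: sp; rewrite /s; lra.
have fc p : U p -> {for p, continuous f} by exact: Ck_continuous Cf.
have vc p : U p -> {for p, continuous v} by exact: Ck_continuous Cv.
(* On the compact K' both f and v are bounded by their maxima, the first of
   which is less than f z. *)
have [d d0 dlt] : exists2 d, 0 < d & forall p, K' p -> f p + d * v p < f z.
  have [[p0 Kp0]|/set0P/negP] := pselect (K' !=set0); last first.
    move=> /negPn/eqP K'0; exists 1 => // p; by rewrite K'0.
  have K'U p : K' p -> U p by move=> [/inball[]].
  have [c1 Kc1 max1] := exists_max_on (ex_intro _ p0 Kp0) cK'
    (continuous_for_within (fun p Kp => fc p (K'U p Kp))).
  have [c2 Kc2 max2] := exists_max_on (ex_intro _ p0 Kp0) cK'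
    (continuous_for_within (fun p Kp => vc p (K'U p Kp))).
  have m0 : 0 < f z - f c1 by rewrite subr_gt0; exact: K'lt.
  have n0 : 0 < `|v c2| + 1 by rewrite ltr_wpDl.
  exists ((f z - f c1) / (`|v c2| + 1)); first exact: divr_gt0.
  move=> p Kp; apply: (@le_lt_trans _ _ (f c1 + (f z - f c1) / (`|v c2| + 1) * `|v c2|)).
    rewrite lerD ?max1// ler_wpM2l//; first exact/ltW/divr_gt0.
    by rewrite (le_trans (max2 p Kp))// ler_norm.
  rewrite -ltrBrDl mulrAC ltr_pdivrMr// ltr_pM2l//; lra.
pose g p : R^o := f p + d * v p.
have Cdv := CkZ d oU Cv.
have Cg : Ck 2 U g := CkD oU Cf Cdv.
have Kz : K z by rewrite /K/= subrr normr0 ltW.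
have KU p : K p -> U p by move=> /inball[].
have [q Kq gmax] := exists_max_on (ex_intro _ z Kz) cK
  (continuous_for_within (fun p Kp => Ck_continuous Cg (KU p Kp))).
have gz : g z = f z by rewrite /g /v sz; ring.
have [Uq Lvq pos_q] := inball q Kq.
have qr : `|q - z| < r.
  rewrite lt_neqAle; apply/andP; split; last exact: Kq.
  apply/eqP => qr; have := gmax z Kz; rewrite gz leNgt => /negP; apply.
  have [sq|sq] := leP 0 (s q); first by apply: dlt.
  rewrite /g (@lt_le_trans _ _ (f q))//; last exact: fmax.
  rewrite gtrDl pmulr_rlt0// (_ : v q = s q * (1 + A * s q)); last by rewrite /v; ring.
  by rewrite pmulr_llt0.
have oB : open (ball z r : set 'rV[R]_2) by exact: ball_open.
have Bq : ball z r q by rewrite -ball_normE /ball_/= distrC.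
have subB : ball z r `<=` U.
  move=> p; rewrite -ball_normE /ball_/= distrC => /ltW pr.
  exact: KU.
have : diffop a b g q <= 0.
  apply: (diffop_max b oB (Ck_subset subB Cg) Bq); last exact: ell.
  by move=> p; rewrite -ball_normE /ball_/= distrC => /ltW; exact: gmax.
rewrite (diffopD a b oU Cf Cdv Uq) (diffopZ a b d oU Cv Uq) leNgt => /negP; apply.
by rewrite ltr_wpDl ?Lf// mulr_gt0.
Qed.

(** If f takes a smaller value at a point y close to x, then the largest disc
    around y on which f is smaller than f x touches the set where f = f x at
    some z, and [hopf_touching] applies.  The distances ensure that this disc
    lies in U. *)
Lemma hopf a b U f x : open U -> Ck 2 U f ->
  (forall p, U p -> elliptic a p) ->
  (forall p i j, U p -> {for p, continuous (a i j)}) ->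
  (forall p i, U p -> {for p, continuous (b i)}) ->
  (forall p, U p -> 0 <= diffop a b f p) ->
  U x -> (forall p, U p -> f p <= f x) -> \forall p \near x, f p = f x.
Proof.
move=> oU Cf ell ac bc Lf Ux fmax.
have /nbhs_ballP[e /= e0 eU] : \forall p \near x, U p by exact: open_nbhs_nbhs.
pose r := e / 4; have r0 : 0 < r by exact: divr_gt0.
have inU p : `|p - x| <= 3 * r -> U p.
  move=> pr; apply: eU; rewrite -ball_normE /ball_/= distrC.
  by rewrite (le_lt_trans pr)// /r; lra.
apply/nbhs_ballP; exists r => //= y; rewrite -ball_normE /ball_/= distrC => yr.
apply: contrapT => fy.
have Uy : U y by apply: inU; move: yr; lra.
have fylt : f y < f x by rewrite lt_neqAle fmax// andbT; exact/eqP.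
pose A := [set p | `|p - x| <= 3 * r] `&` [set p | f p = f x].
have Ax : A x by split=> //=; rewrite subrr normr0; lra.
have cA : compact A.
  have cB := @compact_norm_ball _ x (3 * r).
  have fc : {within [set p | `|p - x| <= 3 * r], continuous f}.
    by apply: continuous_for_within => p /inU; exact: Ck_continuous Cf.
  apply: (subclosed_compact _ cB); last by move=> p [].
  have := closed_superlevel (c := f x) (compact_closed (@norm_hausdorff _ _) cB) fc.
  congr closed; apply/seteqP; split=> p [pr /= h]; split=> //=.
    by apply/eqP; rewrite eq_le h fmax//; exact: inU.
  by rewrite h.
have sqc k : {for k, continuous (fun p => - sqdist y p : R^o)}.
  have : Ck 2 setT (fun p => - sqdist y p : R^o).
    by apply: CkN; [exact: openT|exact: Ck_sqdist].
  by move/Ck_continuous; exact.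
have [z [zr fz] zmin] := exists_max_on (ex_intro _ x Ax) cA
  (continuous_for_within (fun p _ => sqc p)).
have zx : sqdist y z <= sqdist y x by rewrite -lerN2; exact: zmin.
(* In the supremum norm |y - x| < r gives sqdist y x <= 2 r^2 <= (2 r)^2, and
   sqdist y p <= (2 r)^2 gives |p - y| <= 2 r. *)
have near_y p : sqdist y p <= sqdist y x -> `|p - x| <= 3 * r.
  move=> px; have : `|p - y| <= 2 * r.
    apply: norm_le_sqdist; first lra.
    apply: le_trans px _; apply: (@le_trans _ _ (r ^+ 2 *+ 2)).
      by apply: sqdist_le; rewrite distrC ltW.
    by have := sqr_ge0 r; lra.
  have := ler_normD (p - y) (y - x); rewrite addrA subrK; lra.
apply: (@hopf_touching a b U f z y) => //.
- exact: inU.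
- by apply: contraTneq fylt => <-; rewrite fz ltxx.
- by rewrite fz.
- move=> p Up pz; rewrite fz lt_neqAle fmax// andbT; apply/eqP => fp.
  have : A p by split=> //; apply: near_y; apply: le_trans zx; exact: ltW.
  by move/zmin; rewrite lerN2 leNgt pz.
Qed.

End Hopf.

(** * The Laplace-Beltrami operator in a chart *)

Section Metric.
Context {R : realType}.
Implicit Types (U : set 'rV[R]_2) (x y : 'rV[R]_2) (i j : 'I_2)
  (p q r f g : 'rV[R]_2 -> R^o).

(** The symmetric matrix with rows (u, v) and (v, w), as a function of the
    indices. *)
Definition sym2 (u v w : R) i j : R :=
  if i == j then if i == 0 then u else w else v.

Lemma ord2P (P : 'I_2 -> Prop) : P 0 -> P 1 -> forall i, P i.
Proof.
move=> P0 P1 [[|[|//]] h]; [move: P0|move: P1]; congr P; exact/val_inj.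
Qed.

Lemma det_sym2 (A : 'M[R]_2) (u v w : R) : (forall i j, A i j = sym2 u v w i j) ->
  \det A = u * w - v * v.
Proof.
move=> AE; rewrite (expand_det_row _ 0) sum_ord2 /cofactor !det_mx11 !mxE !AE /=.
have -> : lift 0 (0 : 'I_1) = 1 :> 'I_2 by exact/val_inj.
have -> : lift 1 (0 : 'I_1) = 0 :> 'I_2 by exact/val_inj.
by rewrite /sym2/= /bump/= !expr0 expr1 mul1r mulN1r mulrN.
Qed.

Lemma invmx_sym2 (A : 'M[R]_2) (u v w : R) : (forall i j, A i j = sym2 u v w i j) ->
  u * w - v * v != 0 ->
  forall i j, invmx A i j = sym2 (w / (u * w - v * v)) (- v / (u * w - v * v))
    (u / (u * w - v * v)) i j.
Proof.
move=> AE d0.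
pose B : 'M[R]_2 := \matrix_(i, j) sym2 (w / (u * w - v * v))
  (- v / (u * w - v * v)) (u / (u * w - v * v)) i j.
have AB : A *m B = 1%:M.
  apply/matrixP => i j; rewrite !mxE sum_ord2 !mxE !AE; move: i j.
  by apply: ord2P; apply: ord2P; rewrite /sym2/=; field.
have -> : invmx A = B.
  have uA : A \in unitmx by rewrite unitmxE unitfE (det_sym2 AE).
  by rewrite -[LHS]mulmx1 -AB mulKmx.
by move=> i j; rewrite mxE.
Qed.

Definition metric_det p q r y : R^o := p y * r y - q y * q y.

Definition inv_metric p q r i j y : R :=
  sym2 (r y / metric_det p q r y) (- q y / metric_det p q r y)
    (p y / metric_det p q r y) i j.

Definition inv_vol p q r y : R^o := (Num.sqrt (metric_det p q r y))^-1.

(** The inverse metric times the area density: the coefficients of the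
    Laplacian in divergence form. *)
Definition flux_coef p q r i j y : R :=
  sym2 (r y * inv_vol p q r y) (- q y * inv_vol p q r y) (p y * inv_vol p q r y) i j.

(** The first-order coefficients that appear when the divergence form is
    expanded. *)
Definition lb_drift p q r j y : R :=
  inv_vol p q r y *
  (grad (flux_coef p q r 0 j) y 0 + grad (flux_coef p q r 1 j) y 1).

Lemma Ck_sym2 k U f g h i j : Ck k U f -> Ck k U g -> Ck k U h ->
  Ck k U (fun y => sym2 (f y) (g y) (h y) i j : R^o).
Proof. by rewrite /sym2; case: (_ == _) => //; case: (_ == _). Qed.

Section Chart.
Variables (U : set 'rV[R]_2) (p q r : 'rV[R]_2 -> R^o).
Hypothesis oU : open U.
Hypothesis det_gt0 : forall y, U y -> 0 < metric_det p q r y.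

Lemma Ck_metric_det k : Ck k U p -> Ck k U q -> Ck k U r ->
  Ck k U (metric_det p q r).
Proof.
by move=> Cp Cq Cr; exact: (CkB oU (CkM oU Cp Cr) (CkM oU Cq Cq)).
Qed.

Lemma Ck_inv_vol k : Ck k U p -> Ck k U q -> Ck k U r -> Ck k U (inv_vol p q r).
Proof.
move=> Cp Cq Cr; apply: (CkV oU); last exact: (Ck_sqrt oU det_gt0 (Ck_metric_det Cp Cq Cr)).
by move=> y /det_gt0 h; rewrite gt_eqF// sqrtr_gt0.
Qed.

Lemma Ck_inv_metric k i j : Ck k U p -> Ck k U q -> Ck k U r ->
  Ck k U (inv_metric p q r i j : 'rV[R]_2 -> R^o).
Proof.
move=> Cp Cq Cr.
have CD : Ck k U (fun y => (metric_det p q r y)^-1 : R^o).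
  by apply: (CkV oU _ (Ck_metric_det Cp Cq Cr)) => y /det_gt0/lt0r_neq0.
exact: (Ck_sym2 i j (CkM oU Cr CD) (CkM oU (CkN oU Cq) CD) (CkM oU Cp CD)).
Qed.

Lemma Ck_flux_coef k i j : Ck k U p -> Ck k U q -> Ck k U r ->
  Ck k U (flux_coef p q r i j : 'rV[R]_2 -> R^o).
Proof.
move=> Cp Cq Cr; have Ct := Ck_inv_vol Cp Cq Cr.
exact: (Ck_sym2 i j (CkM oU Cr Ct) (CkM oU (CkN oU Cq) Ct) (CkM oU Cp Ct)).
Qed.

Lemma Ck_lb_drift j : Ck 1 U p -> Ck 1 U q -> Ck 1 U r ->
  Ck 0 U (lb_drift p q r j : 'rV[R]_2 -> R^o).
Proof.
move=> Cp Cq Cr; apply: (CkM oU (Ck_pred (Ck_inv_vol Cp Cq Cr))).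
exact: (CkD oU (Ck_grad _ (Ck_flux_coef 0 j Cp Cq Cr))
  (Ck_grad _ (Ck_flux_coef 1 j Cp Cq Cr))).
Qed.

Lemma elliptic_inv_metric y : U y -> 0 < r y -> elliptic (inv_metric p q r) y.
Proof.
move=> Uy r0; have D0 := det_gt0 Uy; split; rewrite /inv_metric /sym2/=.
- by [].
- exact: divr_gt0.
- have Dn : metric_det p q r y != 0 by rewrite gt_eqF.
  have -> : r y / metric_det p q r y * (p y / metric_det p q r y) -
     - q y / metric_det p q r y * (- q y / metric_det p q r y) =
     (p y * r y - q y * q y) / metric_det p q r y / metric_det p q r y.
    by move: (metric_det p q r y) Dn => D Dn; field.
  by rewrite -/(metric_det p q r y) mulfV// div1r invr_gt0.
Qed.

Lemma inv_vol_sqr y : U y -> inv_vol p q r y * inv_vol p q r y = (metric_det p q r y)^-1.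
Proof.
move=> /det_gt0 D0; rewrite /inv_vol -invfM -expr2 sqr_sqrtr//; exact: ltW.
Qed.

Lemma sqrt_mul_sym2 y (u v w : R) i j : U y ->
  Num.sqrt (metric_det p q r y) *
  sym2 (u / metric_det p q r y) (v / metric_det p q r y) (w / metric_det p q r y) i j =
  sym2 (u * inv_vol p q r y) (v * inv_vol p q r y) (w * inv_vol p q r y) i j.
Proof.
move=> Uy; have D0 := det_gt0 Uy.
have H c : Num.sqrt (metric_det p q r y) * (c / metric_det p q r y) =
    c * inv_vol p q r y.
  rewrite -(inv_vol_sqr Uy) mulrCA; congr (c * _).
  by rewrite mulrA /inv_vol mulfV ?mul1r// gt_eqF// sqrtr_gt0.
by rewrite /sym2; case: ifP => _; [case: ifP => _|]; exact: H.
Qed.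

Lemma inv_vol_flux i j y : U y ->
  inv_vol p q r y * flux_coef p q r i j y = inv_metric p q r i j y.
Proof.
move=> Uy; rewrite /flux_coef /inv_metric /sym2 -(inv_vol_sqr Uy).
by case: ifP => _; [case: ifP => _|]; ring.
Qed.

(** The area density in front of the divergence form cancels against the one
    inside the divergence, up to the derivatives collected in [lb_drift]. *)
Lemma laplace_beltrami_diffop (G : 'rV[R]_2 -> 'M[R]_2) f x :
  Ck 1 U p -> Ck 1 U q -> Ck 1 U r -> Ck 2 U f -> U x ->
  (forall y, U y -> forall i j, G y i j = sym2 (p y) (q y) (r y) i j) ->
  laplace_beltrami G f x =
  diffop (inv_metric p q r) (lb_drift p q r) f x.
Proof.
move=> Cp Cq Cr Cf Ux GE.
have C1f := Ck_pred Cf.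
have Ca i j := Ck_flux_coef i j Cp Cq Cr.
have CaD i j := CkM oU (Ca i j) (Ck_grad j Cf).
have fluxE i y : U y -> Num.sqrt (\det (G y)) * \sum_j invmx (G y) i j *
    'D_(axis j) f y =
    flux_coef p q r i 0 y * grad f y 0 + flux_coef p q r i 1 y * grad f y 1.
  move=> Uy; rewrite sum_ord2 -!gradE (det_sym2 (GE y Uy)).
  have D0 := det_gt0 Uy.
  rewrite !(invmx_sym2 (GE y Uy)) ?gt_eqF//.
  rewrite mulrDr !mulrA; congr (_ * _ + _ * _).
  - by rewrite sqrt_mul_sym2.
  - by rewrite sqrt_mul_sym2.
have E i : 'D_(axis i) (fun y => Num.sqrt (\det (G y)) * \sum_j invmx (G y) i j *
    'D_(axis j) f y) x =
    grad (fun y => flux_coef p q r i 0 y * grad f y 0 +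
                   flux_coef p q r i 1 y * grad f y 1) x i.
  rewrite gradE; exact: derive_eq_on oU Ux (fluxE i).
rewrite /laplace_beltrami sum_ord2.
rewrite (E 0) (E 1).
rewrite (gradD 0 (CaD 0 0) (CaD 0 1) Ux) (gradD 1 (CaD 1 0) (CaD 1 1) Ux).
rewrite !(gradM _ (Ca _ _) (Ck_grad _ Cf) Ux) -!hessE diffopE.
rewrite (det_sym2 (GE x Ux)) -[(Num.sqrt _)^-1]/(inv_vol p q r x).
rewrite -!(inv_vol_flux _ _ Ux) /lb_drift.
ring.
Qed.
Lemma grad_metric_det i x : Ck 1 U p -> Ck 1 U q -> Ck 1 U r -> U x ->
  grad (metric_det p q r) x i =
  p x * grad r x i + r x * grad p x i - 2 * q x * grad q x i.
Proof.
move=> Cp Cq Cr Ux; have Cqq := CkM oU Cq Cq.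
have E y : U y -> metric_det p q r y = p y * r y + -1 * (q y * q y).
  by move=> _; rewrite mulN1r.
rewrite (grad_eq i oU Ux E) (gradD i (CkM oU Cp Cr) (CkZ (-1) oU Cqq) Ux).
rewrite (gradM i Cp Cr Ux) (gradM i (Ck_cst 1 (-1 : R^o) oU) Cqq Ux).
rewrite (gradM i Cq Cq Ux) grad_const; ring.
Qed.

Lemma grad_mul_inv_vol f i x : Ck 1 U p -> Ck 1 U q -> Ck 1 U r -> Ck 1 U f ->
  U x -> grad (fun y => f y * inv_vol p q r y) x i =
  inv_vol p q r x *
    (grad f x i - f x * grad (metric_det p q r) x i / (2 * metric_det p q r x)).
Proof.
move=> Cp Cq Cr Cf Ux; have D0 := det_gt0 Ux.
have s0 : 0 < Num.sqrt (metric_det p q r x) by rewrite sqrtr_gt0.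
have CD := Ck_metric_det Cp Cq Cr.
have CS := Ck_sqrt oU det_gt0 CD.
have gS : grad (fun y => Num.sqrt (metric_det p q r y)) x i =
    (2 * Num.sqrt (metric_det p q r x))^-1 * grad (metric_det p q r) x i.
  rewrite !gradE; have [_ H] := is_derive_outer (is_derive1_sqrt D0)
    (Ck_derivable (i := i) CD Ux).
  exact: H.
rewrite (gradM i Cf (Ck_inv_vol Cp Cq Cr) Ux).
rewrite (gradV i CS (lt0r_neq0 s0) Ux) gS.
have -> : metric_det p q r x = Num.sqrt (metric_det p q r x) ^+ 2.
  by rewrite sqr_sqrtr// ltW.
rewrite sqrtr_sqr gtr0_norm// /inv_vol.
move: (Num.sqrt _) (lt0r_neq0 s0) => s sn0; field; exact: sn0.
Qed.

(** The square root of the determinant occurs only through its square, so that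
    the drift is rational in the metric and its derivatives. *)
Lemma lb_driftE x : Ck 1 U p -> Ck 1 U q -> Ck 1 U r -> U x ->
  let D := metric_det p q r x in
  let dD := grad (metric_det p q r) x in
  lb_drift p q r 0 x = (grad r x 0 - grad q x 1 -
    (r x * dD 0 - q x * dD 1) / (2 * D)) / D /\
  lb_drift p q r 1 x = (grad p x 1 - grad q x 0 -
    (p x * dD 1 - q x * dD 0) / (2 * D)) / D.
Proof.
move=> Cp Cq Cr Ux D dD.
have Cq' := CkN oU Cq.
have gN i : grad (fun y => - q y) x i = - grad q x i.
  by rewrite !gradE; have [_ ->] := is_deriveN (CkP i Cq Ux); rewrite gradE.
have G i := grad_mul_inv_vol i Cp Cq Cr.
rewrite /lb_drift.
rewrite -[flux_coef p q r 0 0]/(fun y => r y * inv_vol p q r y).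
rewrite -[flux_coef p q r 1 0]/(fun y => - q y * inv_vol p q r y).
rewrite -[flux_coef p q r 0 1]/(fun y => - q y * inv_vol p q r y).
rewrite -[flux_coef p q r 1 1]/(fun y => p y * inv_vol p q r y).
rewrite !G// !gN -/D -/(dD 0) -/(dD 1) -!mulrDr !mulrA (inv_vol_sqr Ux) -/D.
by split; rewrite mulrC; congr (_ / _); rewrite mulrBl; ring.
Qed.

End Chart.

End Metric.

(** * Vectors of the space *)

Section SpaceVectors.
Context {R : realType}.
Implicit Types (P Q V : 'I_3 -> R).

Definition dot3 P Q : R := P 0 * Q 0 + P 1 * Q 1 + P 2 * Q 2.

Definition cross3 P Q (k : 'I_3) : R := P (k + 1) * Q (k + 2) - P (k + 2) * Q (k + 1).

Lemma sum_ord3 (G : 'I_3 -> R) : \sum_k G k = G 0 + G 1 + G 2.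
Proof.
by rewrite !big_ord_recl big_ord0 addr0 addrA; congr (_ + G _ + G _);
  exact/val_inj.
Qed.

Lemma ord3P (S : 'I_3 -> Prop) : S 0 -> S 1 -> S 2 -> forall k, S k.
Proof.
move=> S0 S1 S2 [[|[|[|//]]] h]; [move: S0|move: S1|move: S2];
  congr S; exact/val_inj.
Qed.

Lemma cross3E P Q : (cross3 P Q 0 = P 1 * Q 2 - P 2 * Q 1) *
  (cross3 P Q 1 = P 2 * Q 0 - P 0 * Q 2) * (cross3 P Q 2 = P 0 * Q 1 - P 1 * Q 0).
Proof.
have e1 : 1 + 1 = 2 :> 'I_3 by exact/val_inj.
have e2 : 1 + 2 = 0 :> 'I_3 by exact/val_inj.
have e3 : 2 + 1 = 0 :> 'I_3 by exact/val_inj.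
have e4 : 2 + 2 = 1 :> 'I_3 by exact/val_inj.
by rewrite /cross3 !add0r e1 e2 e3 e4.
Qed.

Lemma dotE (u v : 'rV[R]_3) P Q :
  (forall k, u 0 k = P k) -> (forall k, v 0 k = Q k) -> dot u v = dot3 P Q.
Proof. by move=> uP vQ; rewrite /dot sum_ord3 !uP !vQ. Qed.

Lemma crossE (u v : 'rV[R]_3) P Q k :
  (forall k, u 0 k = P k) -> (forall k, v 0 k = Q k) -> cross u v 0 k = cross3 P Q k.
Proof. by move=> uP vQ; rewrite mxE !uP !vQ. Qed.

Lemma normalized_crossE (u v : 'rV[R]_3) P Q k :
  (forall k, u 0 k = P k) -> (forall k, v 0 k = Q k) ->
  ((Num.sqrt (dot (cross u v) (cross u v)))^-1 *: cross u v) 0 k =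
  (Num.sqrt (dot3 (cross3 P Q) (cross3 P Q)))^-1 * cross3 P Q k.
Proof.
move=> uP vQ; have H k' := crossE k' uP vQ.
by rewrite mxE (dotE H H) H.
Qed.

Lemma lagrange3 P Q : dot3 (cross3 P Q) (cross3 P Q) =
  dot3 P P * dot3 Q Q - dot3 P Q * dot3 P Q.
Proof. by rewrite /dot3 !cross3E; ring. Qed.

(** P, Q and their cross product form a basis when the Gram determinant of P
    and Q is nonzero; the proof writes V in this basis. *)
Lemma orthogonal_frame_eq0 P Q V :
  dot3 P P * dot3 Q Q - dot3 P Q * dot3 P Q != 0 ->
  dot3 V P = 0 -> dot3 V Q = 0 -> dot3 V (cross3 P Q) = 0 -> forall k, V k = 0.
Proof.
move=> D0 VP VQ VN.
have H k : (dot3 P P * dot3 Q Q - dot3 P Q * dot3 P Q) * V k =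
    (dot3 Q Q * dot3 V P - dot3 P Q * dot3 V Q) * P k +
    (dot3 P P * dot3 V Q - dot3 P Q * dot3 V P) * Q k +
    dot3 V (cross3 P Q) * cross3 P Q k.
  by move: k; apply: ord3P; rewrite /dot3 !cross3E; ring.
by move=> k; apply: (mulfI D0); rewrite H VP VQ VN; ring.
Qed.

End SpaceVectors.

(** * Minimal immersions of plane domains *)

Section MinimalImmersion.
Context {R : realType}.
Variables (U : set 'rV[R]_2) (F : 'rV[R]_2 -> 'rV[R]_3).
Hypothesis oU : open U.
Hypothesis F_smooth : smooth_on U F.
Hypothesis F_free : forall y, U y -> free [:: 'D_(axis 0) F y; 'D_(axis 1) F y].
Hypothesis F_minimal : forall y, U y -> mean_curvature F y = 0.

Definition coordf (k : 'I_3) (y : 'rV[R]_2) : R^o := F y 0 k.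

(** The coordinates of the partial derivatives of F, as real functions. *)
Definition tang (y : 'rV[R]_2) (i : 'I_2) (k : 'I_3) : R := grad (coordf k) y i.

Definition tang2 (y : 'rV[R]_2) (i j : 'I_2) (k : 'I_3) : R := hess (coordf k) y i j.

Definition gram (i j : 'I_2) (y : 'rV[R]_2) : R^o := dot3 (tang y i) (tang y j).

Notation a := (inv_metric (gram 0 0) (gram 0 1) (gram 1 1)).
Notation b := (lb_drift (gram 0 0) (gram 0 1) (gram 1 1)).
Notation D := (metric_det (gram 0 0) (gram 0 1) (gram 1 1)).

Lemma Ck_coordf n k : Ck n U (coordf k).
Proof. exact: (Ck_coord k oU (F_smooth n)). Qed.

Lemma Ck_gram n i j : Ck n U (gram i j).
Proof.
have C k l := Ck_grad l (Ck_coordf n.+1 k).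
exact: (CkD oU (CkD oU (CkM oU (C 0 i) (C 0 j)) (CkM oU (C 1 i) (C 1 j)))
  (CkM oU (C 2 i) (C 2 j))).
Qed.

Lemma tangE y i k : U y -> 'D_(axis i) F y 0 k = tang y i k.
Proof.
move=> Uy; rewrite /tang gradE derive_coord//.
exact: Ck_derivable (F_smooth 1) Uy.
Qed.

Lemma tang2E y i j k : U y -> 'D_(axis i) ('D_(axis j) F) y 0 k = tang2 y i j k.
Proof.
move=> Uy; rewrite /tang2 hessE gradE derive_coord; last first.
  exact: Ck_derivable (Ck_derive j (F_smooth 2)) Uy.
apply: derive_eq_on oU Uy _ => z Uz; exact: tangE.
Qed.

Lemma tang2C y i j k : U y -> tang2 y i j k = tang2 y j i k.
Proof. by move=> Uy; rewrite /tang2 !hess.unlock; exact: schwarz (Ck_coordf 2 k) Uy. Qed.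

Lemma first_formE y i j : U y ->
  first_form F y i j = sym2 (gram 0 0 y) (gram 0 1 y) (gram 1 1 y) i j.
Proof.
move=> Uy; rewrite mxE (dotE (fun k => tangE i k Uy) (fun k => tangE j k Uy)).
by move: i j; apply: ord2P; apply: ord2P; rewrite /sym2 //= /gram /dot3; ring.
Qed.

(** The second of two independent vectors is nonzero. *)
Lemma gram11_gt0 y : U y -> 0 < gram 1 1 y.
Proof.
move=> Uy; have := F_free Uy; rewrite free_cons seq1_free => /andP[_ Q0].
rewrite lt_neqAle /gram /dot3 -!expr2 !addr_ge0 ?sqr_ge0// andbT eq_sym.
apply: contra Q0; rewrite !paddr_eq0 ?addr_ge0 ?sqr_ge0// !sqrf_eq0.
move=> /andP[/andP[/eqP h0 /eqP h1] /eqP h2]; apply/eqP/rowP => k.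
by rewrite (tangE 1 k Uy) mxE; move: k; apply: ord3P.
Qed.

(** By Lagrange's identity the determinant is the squared length of the cross
    product, hence nonnegative.  If it vanished, so would the vector V below,
    whose squared length is a multiple of it, and the partial derivatives of F
    would be proportional. *)
Lemma metric_det_gt0 y : U y -> 0 < D y.
Proof.
move=> Uy; have r0 := gram11_gt0 Uy; rewrite lt_neqAle; apply/andP; split; last first.
  by rewrite /metric_det -lagrange3 /dot3 -!expr2 !addr_ge0 ?sqr_ge0.
apply/eqP => /esym D0.
have := F_free Uy; rewrite free_cons span_seq1 => /andP[/negP + _]; apply.
apply/vlineP; exists (gram 0 1 y / gram 1 1 y); apply/rowP => k.
rewrite mxE (tangE 0 k Uy) (tangE 1 k Uy).
pose V k := gram 1 1 y * tang y 0 k - gram 0 1 y * tang y 1 k.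
have VV : dot3 V V = 0.
  have -> : dot3 V V = gram 1 1 y * D y.
    by rewrite /V /metric_det /gram /dot3; ring.
  by rewrite D0 mulr0.
have V0 : forall k, V k = 0.
  move: VV; rewrite /dot3 -!expr2 => /eqP.
  rewrite !paddr_eq0 ?addr_ge0 ?sqr_ge0// !sqrf_eq0.
  by move=> /andP[/andP[/eqP h0 /eqP h1] /eqP h2]; apply: ord3P.
have /eqP := V0 k; rewrite subr_eq0 => /eqP h.
by apply: (mulfI (lt0r_neq0 r0)); rewrite h mulrA mulrCA mulfV ?mulr1// gt_eqF.
Qed.

Lemma elliptic_chart y : U y -> elliptic a y.
Proof.
by move=> Uy; apply: (elliptic_inv_metric metric_det_gt0 Uy); exact: gram11_gt0.
Qed.

Lemma laplace_chart f x : Ck 2 U f -> U x ->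
  laplace_beltrami (first_form F) f x = diffop a b f x.
Proof.
move=> Cf Ux; apply: (laplace_beltrami_diffop oU metric_det_gt0 _ _ _ Cf Ux);
  try exact: Ck_gram.
by move=> y Uy i j; exact: first_formE.
Qed.

Lemma grad_gram i j l x : U x ->
  grad (gram i j) x l = dot3 (tang2 x l i) (tang x j) + dot3 (tang2 x l j) (tang x i).
Proof.
move=> Ux; have C k m := Ck_grad m (Ck_coordf 2 k).
have CM k := CkM oU (C k i) (C k j).
rewrite (gradD l (CkD oU (CM 0) (CM 1)) (CM 2) Ux) (gradD l (CM 0) (CM 1) Ux).
rewrite !(gradM l (C _ i) (C _ j) Ux) -!hessE /dot3 /tang2 /tang; ring.
Qed.

(** The mean curvature is, up to positive factors, the normal component of the
    second-order part of the Laplacian of F. *)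
Lemma mean_curvature_normal x : U x ->
  dot3 (fun k => gram 1 1 x * tang2 x 0 0 k - 2 * gram 0 1 x * tang2 x 0 1 k +
                 gram 0 0 x * tang2 x 1 1 k) (cross3 (tang x 0) (tang x 1)) = 0.
Proof.
move=> Ux; have D0 := metric_det_gt0 Ux; have := F_minimal Ux.
pose N := cross3 (tang x 0) (tang x 1).
have NN : dot3 N N = D x by rewrite lagrange3.
pose c := (Num.sqrt (dot3 N N))^-1.
have c0 : c != 0 by rewrite invr_eq0 NN gt_eqF// sqrtr_gt0.
have IIE i j : second_form F x i j = c * dot3 (tang2 x i j) N.
  rewrite mxE (dotE (fun k => tang2E i j k Ux)
    (fun k => normalized_crossE k (fun k => tangE 0 k Ux) (fun k => tangE 1 k Ux))).
  by rewrite -/N -/c /dot3; ring.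
move=> /eqP; rewrite /mean_curvature mulf_eq0 invr_eq0 pnatr_eq0 orbF.
rewrite /mxtrace sum_ord2 !mxE !sum_ord2 !IIE.
have inv := invmx_sym2 (fun i j => first_formE i j Ux) (lt0r_neq0 D0).
rewrite !inv /sym2/= -/(D x) -/N.
have -> : dot3 (tang2 x 1 0) N = dot3 (tang2 x 0 1) N.
  by rewrite /dot3 !(tang2C 1 0 _ Ux).
set T00 := dot3 (tang2 x 0 0) N; set T01 := dot3 (tang2 x 0 1) N.
set T11 := dot3 (tang2 x 1 1) N.
have -> : gram 1 1 x / D x * (c * T00) + - gram 0 1 x / D x * (c * T01) +
    (- gram 0 1 x / D x * (c * T01) + gram 0 0 x / D x * (c * T11)) =
  c / D x * (gram 1 1 x * T00 - 2 * gram 0 1 x * T01 + gram 0 0 x * T11).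
  by move: (D x) (lt0r_neq0 D0) => d d0; field.
rewrite !mulf_eq0 (negbTE c0) invr_eq0 (gt_eqF D0)/= => /eqP <-.
by rewrite /T00 /T01 /T11 /dot3; ring.
Qed.

(** The Laplacian of an immersion is orthogonal to the two tangent vectors, by
    the formula for the drift, whatever the immersion is; its component along
    the normal is the mean curvature, which vanishes. *)
Lemma coordf_harmonic x k : U x -> diffop a b (coordf k) x = 0.
Proof.
move=> Ux; have D0 := metric_det_gt0 Ux.
have C1 i j := Ck_gram 1 i j.
have [b0 b1] := lb_driftE oU metric_det_gt0 (C1 0 0) (C1 0 1) (C1 1 1) Ux.
pose W k := gram 1 1 x * tang2 x 0 0 k - 2 * gram 0 1 x * tang2 x 0 1 k +
  gram 0 0 x * tang2 x 1 1 k.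
have VE l : diffop a b (coordf l) x =
    (D x)^-1 * W l + (b 0 x * tang x 0 l + b 1 x * tang x 1 l).
  rewrite diffopE -/(tang x 0 l) -/(tang x 1 l) -/(tang2 x 0 0 l).
  rewrite -/(tang2 x 0 1 l) -/(tang2 x 1 0 l) -/(tang2 x 1 1 l) (tang2C 1 0 l Ux).
  by rewrite /W /inv_metric /sym2/=; move: (D x) => d; ring.
move: b0 b1; rewrite !(grad_metric_det oU _ (C1 _ _) (C1 _ _) (C1 _ _) Ux).
rewrite !(grad_gram _ _ _ Ux).
have T10 Q : dot3 (tang2 x 1 0) Q = dot3 (tang2 x 0 1) Q.
  by rewrite /dot3 !(tang2C 1 0 _ Ux).
rewrite !T10 => b0 b1.
have dotV Q : dot3 (fun l => diffop a b (coordf l) x) Q =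
    (D x)^-1 * (gram 1 1 x * dot3 (tang2 x 0 0) Q -
      2 * gram 0 1 x * dot3 (tang2 x 0 1) Q + gram 0 0 x * dot3 (tang2 x 1 1) Q) +
    (b 0 x * dot3 (tang x 0) Q + b 1 x * dot3 (tang x 1) Q).
  by rewrite /dot3 !VE /W; ring.
have gram10 : dot3 (tang x 1) (tang x 0) = gram 0 1 x by rewrite /gram /dot3; ring.
move: k; apply: (@orthogonal_frame_eq0 _ (tang x 0) (tang x 1)).
- by rewrite gt_eqF.
- rewrite dotV b0 b1 gram10 -/(gram 0 0 x); move: D0; rewrite /metric_det => D0.
  move: (gram 0 0 x) (gram 0 1 x) (gram 1 1 x) D0 => p q r /lt0r_neq0 D0.
  move: (dot3 (tang2 x 0 0) (tang x 0)) (dot3 (tang2 x 0 1) (tang x 0))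
    (dot3 (tang2 x 1 1) (tang x 0)) (dot3 (tang2 x 0 0) (tang x 1))
    (dot3 (tang2 x 0 1) (tang x 1)) (dot3 (tang2 x 1 1) (tang x 1)).
  by move=> A00 A01 A11 B00 B01 B11; field; exact: D0.
- rewrite dotV b0 b1 -/(gram 0 1 x) -/(gram 1 1 x); move: D0; rewrite /metric_det => D0.
  move: (gram 0 0 x) (gram 0 1 x) (gram 1 1 x) D0 => p q r /lt0r_neq0 D0.
  move: (dot3 (tang2 x 0 0) (tang x 0)) (dot3 (tang2 x 0 1) (tang x 0))
    (dot3 (tang2 x 1 1) (tang x 0)) (dot3 (tang2 x 0 0) (tang x 1))
    (dot3 (tang2 x 0 1) (tang x 1)) (dot3 (tang2 x 1 1) (tang x 1)).
  by move=> A00 A01 A11 B00 B01 B11; field; exact: D0.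
- have PN : dot3 (tang x 0) (cross3 (tang x 0) (tang x 1)) = 0.
    by rewrite /dot3 !cross3E; ring.
  have QN : dot3 (tang x 1) (cross3 (tang x 0) (tang x 1)) = 0.
    by rewrite /dot3 !cross3E; ring.
  rewrite dotV PN QN !mulr0 !addr0.
  rewrite (_ : _ - _ + _ = dot3 W (cross3 (tang x 0) (tang x 1))); last first.
    by rewrite /W /dot3; ring.
  by rewrite (mean_curvature_normal Ux) mulr0.
Qed.

Definition horiz2 (y : 'rV[R]_2) : R^o :=
  coordf 0 y * coordf 0 y + coordf 1 y * coordf 1 y.

(** The function log r - x3^2, where r is the distance to the vertical axis. *)
Definition log_barrier (y : 'rV[R]_2) : R^o :=
  2^-1 * ln (horiz2 y) + -1 * (coordf 2 y * coordf 2 y).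

Lemma Ck_horiz2 k : Ck k U horiz2.
Proof.
by apply: CkD => //; apply: CkM => //; exact: Ck_coordf.
Qed.

Lemma Ck_log_barrier k : (forall y, U y -> 0 < horiz2 y) -> Ck k U log_barrier.
Proof.
move=> rho0; have CX := Ck_coordf k 2.
exact: (CkD oU (CkZ _ oU (Ck_ln oU rho0 (Ck_horiz2 k))) (CkZ _ oU (CkM oU CX CX))).
Qed.

(** Multiplied by the determinant, the carre du champ of the coordinates k and l
    is the entry (k, l) of |n|^2 I - n n^T, where n is the cross product of the
    tangent vectors; in this form it is polynomial. *)
Lemma carre_coordf k l x : U x ->
  D x * carre a (coordf k) (coordf l) x =
  gram 1 1 x * (tang x 0 k * tang x 0 l) -
  gram 0 1 x * (tang x 0 k * tang x 1 l + tang x 1 k * tang x 0 l) +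
  gram 0 0 x * (tang x 1 k * tang x 1 l).
Proof.
move=> Ux; have D0 := lt0r_neq0 (metric_det_gt0 Ux).
rewrite carreE -!/(tang x _ _) /inv_metric /sym2/=.
by move: (D x) D0 => d d0; field.
Qed.

(** With n the unit normal, the Laplacian of log r is at most
    (n_1^2 + n_2^2) / r^2, and n_1^2 + n_2^2 is the squared length of the
    gradient of x3.  As x3 is harmonic, the Laplacian of x3^2 is twice that
    squared length, which is larger once r >= 1.  The inequality for log r is
    the Cauchy-Schwarz inequality between (x1, x2) and (n_1, n_2). *)
Lemma log_barrier_superharmonic x : (forall y, U y -> 0 < horiz2 y) ->
  U x -> 1 <= horiz2 x -> diffop a b log_barrier x <= 0.
Proof.
move=> rho0 Ux rho1; have D0 := metric_det_gt0 Ux.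
have a01 : a 0 1 x = a 1 0 x by [].
have CX k := Ck_coordf 2 k; have CX1 k := Ck_coordf 1 k.
have C00 k := CkM oU (CX k) (CX k).
have Clog := Ck_ln oU rho0 (Ck_horiz2 2).
have Lsq k : diffop a b (fun y => coordf k y * coordf k y) x =
    2 * carre a (coordf k) (coordf k) x.
  by rewrite (diffopM _ a01 oU (CX k) (CX k) Ux) coordf_harmonic// mulr0 !add0r.
have Lrho : diffop a b horiz2 x =
    2 * carre a (coordf 0) (coordf 0) x + 2 * carre a (coordf 1) (coordf 1) x.
  by rewrite /horiz2 (diffopD _ _ oU (C00 0) (C00 1) Ux) !Lsq.
have Crho g : carre a horiz2 g x =
    2 * (coordf 0 x * carre a (coordf 0) g x + coordf 1 x * carre a (coordf 1) g x).
  rewrite /horiz2 (carreD _ _ (Ck_pred (C00 0)) (Ck_pred (C00 1)) Ux).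
  rewrite (carreM _ _ (CX1 0) (CX1 0) Ux) (carreM _ _ (CX1 1) (CX1 1) Ux); ring.
rewrite (diffopD _ _ oU (CkZ _ oU Clog) (CkZ _ oU (C00 2)) Ux).
rewrite (diffopZ _ _ _ oU Clog Ux) (diffopZ _ _ _ oU (C00 2) Ux) Lsq.
rewrite (diffop_ln _ a01 oU (Ck_horiz2 2) rho0 Ux) Lrho Crho.
rewrite !(carreC (coordf _) horiz2 a01) !Crho.
rewrite (carreC (coordf 1) (coordf 0) a01).
have G k l := carre_coordf k l Ux.
set N := cross3 (tang x 0) (tang x 1).
have DN : D x = N 0 ^+ 2 + N 1 ^+ 2 + N 2 ^+ 2.
  by rewrite /metric_det -lagrange3 /dot3 -!expr2.
have G00 : D x * carre a (coordf 0) (coordf 0) x = D x - N 0 ^+ 2.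
  by rewrite G DN /N !cross3E /gram /dot3; ring.
have G11 : D x * carre a (coordf 1) (coordf 1) x = D x - N 1 ^+ 2.
  by rewrite G DN /N !cross3E /gram /dot3; ring.
have G22 : D x * carre a (coordf 2) (coordf 2) x = D x - N 2 ^+ 2.
  by rewrite G DN /N !cross3E /gram /dot3; ring.
have G01 : D x * carre a (coordf 0) (coordf 1) x = - (N 0 * N 1).
  by rewrite G /N !cross3E /gram /dot3; ring.
have rhoE : horiz2 x = coordf 0 x ^+ 2 + coordf 1 x ^+ 2 by rewrite /horiz2 -!expr2.
move: G00 G11 G22 G01 DN rhoE (rho0 x Ux) rho1 D0.
move: (carre _ _ _ _) (carre _ _ _ _) (carre _ _ _ _) (carre _ _ _ _).
move: (coordf 0 x) (coordf 1 x) (horiz2 x) (D x) (N 0) (N 1) (N 2).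
move=> X Y rho d n0 n1 n2 g1 g2 g3 g4 G00 G11 G22 G01 DN rhoE rho_gt0 rho_ge1 d0.
have dr : 0 < d * rho ^+ 2 by rewrite mulr_gt0// exprn_gt0.
rewrite -(pmulr_rle0 _ dr).
have -> : d * rho ^+ 2 * (2^-1 * (rho^-1 * (2 * g4 + 2 * g3) -
    rho^-1 ^+ 2 * (2 * (X * (2 * (X * g4 + Y * g1)) + Y * (2 * (X * g1 + Y * g3))))) +
    -1 * (2 * g2)) =
  rho * (d * g4 + d * g3) - 2 * (X ^+ 2 * (d * g4) + 2 * X * Y * (d * g1) +
    Y ^+ 2 * (d * g3)) - 2 * rho ^+ 2 * (d * g2).
  by move: rho_gt0 => /lt0r_neq0 rn; field.
rewrite G00 G11 G22 G01 DN.
have -> : rho * (n0 ^+ 2 + n1 ^+ 2 + n2 ^+ 2 - n0 ^+ 2 +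
      (n0 ^+ 2 + n1 ^+ 2 + n2 ^+ 2 - n1 ^+ 2)) -
    2 * (X ^+ 2 * (n0 ^+ 2 + n1 ^+ 2 + n2 ^+ 2 - n0 ^+ 2) + 2 * X * Y * - (n0 * n1) +
      Y ^+ 2 * (n0 ^+ 2 + n1 ^+ 2 + n2 ^+ 2 - n1 ^+ 2)) -
    2 * rho ^+ 2 * (n0 ^+ 2 + n1 ^+ 2 + n2 ^+ 2 - n2 ^+ 2) =
  - (rho * (n0 ^+ 2 + n1 ^+ 2) * (2 * rho - 1) + 2 * (X * n1 - Y * n0) ^+ 2).
  by rewrite rhoE; ring.
rewrite oppr_le0; apply: addr_ge0; last by rewrite mulr_ge0// sqr_ge0.
apply: mulr_ge0; last by move: rho_ge1; lra.
by rewrite mulr_ge0 ?addr_ge0 ?sqr_ge0// ltW.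
Qed.

Lemma subharmonic_interior_max g x : Ck 2 U g ->
  (forall y, U y -> 0 <= laplace_beltrami (first_form F) g y) ->
  U x -> (forall y, U y -> g y <= g x) -> \forall y \near x, g y = g x.
Proof.
move=> Cg Lg Ux gmax.
apply: (hopf (a := a) (b := b) oU Cg) => //.
- by move=> y; exact: elliptic_chart.
- move=> y i j Uy.
  exact: Ck_continuous (Ck_inv_metric oU metric_det_gt0 i j (Ck_gram 0 0 0)
    (Ck_gram 0 0 1) (Ck_gram 0 1 1)) Uy.
- move=> y j Uy.
  exact: Ck_continuous (Ck_lb_drift oU metric_det_gt0 j (Ck_gram 1 0 0)
    (Ck_gram 1 0 1) (Ck_gram 1 1 1)) Uy.
- by move=> y Uy; rewrite -laplace_chart//; exact: Lg.
Qed.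

End MinimalImmersion.

(** * Charts of a surface with boundary *)

Lemma Ck_local {R : realType} {V : normedModType R} k (U : set 'rV[R]_2)
    (g : 'rV[R]_2 -> V) :
  (forall x, U x -> exists2 O : set 'rV[R]_2, O x & Ck k O g) -> Ck k U g.
Proof.
elim: k g => [|k IH] g H.
  by split=> // x /H[B Bx [gc _]]; exact: gc.
split=> [x /H[B Bx [gc _]]|i]; first exact: gc.
split=> [x /H[B Bx Cg]|]; first exact: Ck_derivable Cg Bx.
by apply: IH => x /H[B Bx Cg]; exists B => //; exact: Ck_derive.
Qed.

Section ChartTopology.
Context {R : realType} {M : surface R}.
Implicit Types (c : chart R M) (p q : M) (W : set M) (U : set 'rV[R]_2).

Lemma cmap_continuous_at c p : cdom c p -> {for p, continuous (cmap c)}.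
Proof.
move=> cp; have := @cmap_continuous _ _ c.
rewrite continuous_open_subspace; last exact: cdom_open.
by apply; exact: mem_set.
Qed.

Lemma cmapKin c p : cdom c p -> cinv c (cmap c p) = p.
Proof. by move=> cp; apply: cmapK; exact: mem_set. Qed.

(** A chart that sends p above the boundary line of the half-plane is, near p,
    a chart of an ordinary surface: its image is a neighbourhood of the image
    of p. *)
Lemma interior_chart_nbhs c p W : cdom c p -> 0 < cmap c p 0 1 -> open W -> W p ->
  exists U, [/\ open U, U (cmap c p) & U `<=` cmap c @` (cdom c `&` W)].
Proof.
move=> cp p0 oW Wp; have [ O oO imE] := @cimage_open _ _ c.
pose O' : set 'rV[R]_2 := O `&` [set x | 0 < x 0 1].
have oO' : open O'.
  apply: openI => //; apply: (@open_comp _ _ (fun x : 'rV[R]_2 => x 0 1) [set y | 0 < y]).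
    by move=> x _; exact: coord_continuous.
  exact: open_gt.
have subO : O' `<=` cmap c @` cdom c.
  by rewrite imE => x [Ox /= x0]; split=> //; exact: ltW.
have O'p : O' (cmap c p).
  split=> //; have : (cmap c @` cdom c) (cmap c p) by exists p.
  by rewrite imE => -[].
have cinv_at : {for cmap c p, continuous (cinv c)}.
  have := continuous_subspaceW subO (@cinv_continuous _ _ c).
  by rewrite continuous_open_subspace//; apply; exact: mem_set.
exists ((O' `&` cinv c @^-1` W)°); split; first exact: open_interior.
  apply: filterI; first exact: open_nbhs_nbhs.
  by apply: cinv_at; rewrite cmapKin//; exact: open_nbhs_nbhs.
move=> x /interior_subset[ O'x Wx]; have [q cq qx] := subO x O'x.
by exists q => //; split=> //; rewrite -(cmapKin cq) qx.
Qed.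

(** Statements about points near p may be proved in a chart. *)
Lemma near_chart c p (P : M -> Prop) : cdom c p ->
  (\forall y \near cmap c p, P (cinv c y)) -> \forall q \near p, P q.
Proof.
move=> cp P_near.
have H : \forall q \near p, P (cinv c (cmap c q)).
  exact: (cmap_continuous_at cp P_near).
have cN : \forall q \near p, cdom c q.
  by apply: open_nbhs_nbhs; split=> //; exact: cdom_open.
by move: H cN; apply: filterS2 => q /= + cq; rewrite cmapKin.
Qed.

Lemma open_surface_interior : open (@surface_interior R M).
Proof.
rewrite openE => p [c [ac cp p0]]; rewrite /interior.
have cN : \forall q \near p, cdom c q.
  by apply: open_nbhs_nbhs; split=> //; exact: cdom_open.
have pos : \forall q \near p, 0 < cmap c q 0 1.
  have : {for p, continuous (fun q => cmap c q 0 1 : R^o)}.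
    by apply: (@continuous_comp _ _ _ (cmap c) (fun x : 'rV[R]_2 => x 0 1));
      [exact: cmap_continuous_at|exact: coord_continuous].
  by move/cvgr_gt; exact.
by move: cN pos; apply: filterS2 => q cq q0; exists c.
Qed.

Lemma smooth_map_continuous (f : M -> 'rV[R]_3) p :
  smooth_map f -> {for p, continuous f}.
Proof.
move=> fs; have [c ac cp] := atlas_cover p.
have [|F [ O [oO Op FO FE]]] := fs c ac (cmap c p); first by exists p.
apply: (near_eq_continuous (f := F \o cmap c)).
  have cN : \forall q \near p, cdom c q.
    by apply: open_nbhs_nbhs; split=> //; exact: cdom_open.
  have ON : \forall q \near p, O (cmap c q).
    by have cc := cmap_continuous_at cp; apply: cc; exact: open_nbhs_nbhs.
  move: cN ON; apply: filterS2 => q cq Oq /=.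
  by rewrite FE//=; [rewrite cmapKin|exists q].
apply: continuous_comp; first exact: cmap_continuous_at.
exact: Ck_continuous (FO 0) Op.
Qed.

End ChartTopology.

(** * Subharmonic functions on a minimal surface *)

Section Subharmonic.
Context {R : realType} {M : surface R} (f : M -> 'rV[R]_3).
Hypothesis f_imm : immersion f.
Hypothesis f_min : minimal f.
Implicit Types (c : chart R M) (p q : M) (W : set M) (g : M -> R).

Definition open_in_chart c W (U : set 'rV[R]_2) :=
  [/\ atlas c, open U & U `<=` cmap c @` (cdom c `&` W)].

(** Quantifying over the open pieces of charts makes the notion local: it is
    inherited by subsets, and each piece is a plane domain to which the
    computations on immersions of plane domains apply. *)
Definition subharmonic_on W g := forall c U, open_in_chart c W U ->
  Ck 2 U (g \o cinv c : 'rV[R]_2 -> R^o) /\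
  forall y, U y -> 0 <= laplace_beltrami (induced_metric f c) (g \o cinv c) y.

Section InChart.
Variables (c : chart R M) (W : set M) (U : set 'rV[R]_2).
Hypothesis cWU : open_in_chart c W U.

Let oU : open U. Proof. by case: cWU. Qed.

Lemma open_in_chart_cimage y : U y -> cimage c y.
Proof. by case: cWU => _ _ + Uy => /(_ y Uy)[q [cq _] <-]; exists q. Qed.

Lemma open_in_chart_cinv y : U y -> W (cinv c y).
Proof. by case: cWU => _ _ + Uy => /(_ y Uy)[q [cq Wq] <-]; rewrite cmapKin. Qed.

(** At interior points the immersion read in a chart is its own extension, so
    that the conditions imposed on extensions hold for it. *)
Lemma chart_smooth : smooth_on U (f \o cinv c).
Proof.
move=> k; have [ac _ _] := cWU; apply: Ck_local => x Ux.
have [F [ O [oO Ox FO FE]]] := f_imm.1 c ac x (open_in_chart_cimage Ux).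
exists (O `&` U) => //; apply: (@Ck_eq _ _ _ _ F); first exact: openI.
  by move=> y [ Oy Uy]; apply: FE => //; exact: open_in_chart_cimage.
by apply: (@Ck_subset _ _ _ O) => // y [].
Qed.

Let self_extension y : U y -> smooth_extension (cimage c) (f \o cinv c) y (f \o cinv c).
Proof. by move=> Uy; exists U; split=> //; exact: chart_smooth. Qed.

Lemma chart_free y : U y ->
  free [:: 'D_(axis 0) (f \o cinv c) y; 'D_(axis 1) (f \o cinv c) y].
Proof.
move=> Uy; have [ac _ _] := cWU.
exact: (f_imm.2 c y _ ac (open_in_chart_cimage Uy) (self_extension Uy)).
Qed.

Lemma chart_minimal y : U y -> mean_curvature (f \o cinv c) y = 0.
Proof.
move=> Uy; have [ac _ _] := cWU.
exact: (f_min ac (open_in_chart_cimage Uy) (self_extension Uy)).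
Qed.

Lemma laplace_inv_metric (phi : 'rV[R]_2 -> R^o) y : Ck 2 U phi -> U y ->
  laplace_beltrami (induced_metric f c) phi y =
  diffop (inv_metric (gram (f \o cinv c) 0 0) (gram (f \o cinv c) 0 1)
      (gram (f \o cinv c) 1 1))
    (lb_drift (gram (f \o cinv c) 0 0) (gram (f \o cinv c) 0 1)
      (gram (f \o cinv c) 1 1)) phi y.
Proof. exact: (laplace_chart oU chart_smooth chart_free). Qed.

End InChart.

Lemma subharmonic_onD W g h : subharmonic_on W g -> subharmonic_on W h ->
  subharmonic_on W (fun p => g p + h p).
Proof.
move=> sg sh c U cU; have [Cg Lg] := sg c U cU; have [Ch Lh] := sh c U cU.
have [_ oU _] := cU; have Cgh := CkD oU Cg Ch.
split=> [|y Uy]; first exact: Cgh.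
rewrite (laplace_inv_metric cU Cgh Uy) (diffopD _ _ oU Cg Ch Uy).
rewrite -(laplace_inv_metric cU Cg Uy) -(laplace_inv_metric cU Ch Uy).
by apply: addr_ge0; [exact: Lg|exact: Lh].
Qed.

Lemma subharmonic_on_subset W W' g : W' `<=` W ->
  subharmonic_on W g -> subharmonic_on W' g.
Proof.
move=> sub sg c U [ac oU UW]; apply: sg; split=> // x /UW[q [cq Wq] <-].
by exists q => //; split=> //; exact: sub.
Qed.

Lemma harmonic_subharmonic W (k : R) g : harmonic_on (induced_metric f) W g ->
  subharmonic_on W (fun p => k * g p).
Proof.
move=> hg c U cU; have [ac oU UW] := cU; have [CV LV] := hg c ac.
have Cg : Ck 2 U (g \o cinv c : 'rV[R]_2 -> R^o) := Ck_subset UW CV.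
have Ckg := CkZ k oU Cg.
split=> [|y Uy]; first exact: Ckg.
rewrite (laplace_inv_metric cU Ckg Uy) (diffopZ _ _ k oU Cg Uy).
by rewrite -(laplace_inv_metric cU Cg Uy) LV ?mulr0//; exact: UW.
Qed.

Lemma height_subharmonic W (k : R) : subharmonic_on W (fun p => k * x3 f p).
Proof.
move=> c U cU; have [ac oU UW] := cU.
have sF := chart_smooth cU.
have CX : Ck 2 U (x3 f \o cinv c : 'rV[R]_2 -> R^o) := Ck_coordf oU sF 2 2.
have Ckg := CkZ k oU CX.
split=> [|y Uy]; first exact: Ckg.
rewrite (laplace_inv_metric cU Ckg Uy) (diffopZ _ _ k oU CX Uy).
by rewrite (coordf_harmonic oU sF (chart_free cU) (chart_minimal cU) 2 Uy) mulr0.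
Qed.

Definition horizontal2 p : R := f p 0 0 * f p 0 0 + f p 0 1 * f p 0 1.

Definition log_height p : R := 2^-1 * ln (horizontal2 p) + -1 * (x3 f p * x3 f p).

Lemma log_height_subharmonic W (k : R) : k <= 0 ->
  (forall p, W p -> 1 <= horizontal2 p) -> subharmonic_on W (fun p => k * log_height p).
Proof.
move=> k0 W1 c U cU; have [ac oU UW] := cU.
have sF := chart_smooth cU.
have rho1 y : U y -> 1 <= horiz2 (f \o cinv c) y.
  by move=> Uy; apply: W1; exact: open_in_chart_cinv cU _ Uy.
have rho0 y : U y -> 0 < horiz2 (f \o cinv c) y.
  by move=> /rho1; exact: lt_le_trans.
have CX : Ck 2 U (log_height \o cinv c : 'rV[R]_2 -> R^o) :=
  Ck_log_barrier oU sF 2 rho0.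
have Ckg := CkZ k oU CX.
split=> [|y Uy]; first exact: Ckg.
rewrite (laplace_inv_metric cU Ckg Uy) (diffopZ _ _ k oU CX Uy) mulr_le0//.
exact: (log_barrier_superharmonic oU sF (chart_free cU) (chart_minimal cU) rho0 Uy
  (rho1 y Uy)).
Qed.

(** Hopf's strong maximum principle, transported by a chart. *)
Lemma subharmonic_max_locally_constant W g p : open W -> W p -> surface_interior p ->
  subharmonic_on W g -> (forall q, W q -> g q <= g p) -> \forall q \near p, g q = g p.
Proof.
move=> oW Wp [c [ac cp p0]] sg gmax.
have [U [oU Up UW]] := interior_chart_nbhs cp p0 oW Wp.
have cU : open_in_chart c W U by [].
have [Cg Lg] := sg c U cU.
apply: (near_chart cp); rewrite -[in g p](cmapKin cp).
apply: (subharmonic_interior_max oU (chart_smooth cU) (chart_free cU) Cg Lg Up).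
move=> y Uy /=; rewrite cmapKin//; apply: gmax; exact: open_in_chart_cinv cU _ Uy.
Qed.

End Subharmonic.

(** * Maxima on a connected space *)

Section WithinContinuity.
Context {R : realType} {T : topologicalType}.
Implicit Types (A : set T) (g h : T -> R).

Lemma within_continuousD A g h : {within A, continuous g} ->
  {within A, continuous h} -> {within A, continuous (fun p => g p + h p)}.
Proof. by move=> cg ch p; apply: cvgD; [exact: cg|exact: ch]. Qed.

Lemma within_continuousZ A (k : R) g : {within A, continuous g} ->
  {within A, continuous (fun p => k * g p)}.
Proof. by move=> cg p; apply: cvgM; [exact: cvg_cst|exact: cg]. Qed.

(** The set of maximum points is closed, and open by the last hypothesis, so
    it is the whole space. *)
Lemma connected_max (S : set T) g q : connected [set: T] ->
  closed S -> {within S, continuous g} -> S q -> (forall p, S p -> g p <= g q) ->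
  (forall p, S p -> g p = g q -> \forall p' \near p, S p' /\ g p' = g p) ->
  forall b, S b /\ g b = g q.
Proof.
move=> cT clS cg Sq gmax loc.
pose A := S `&` [set p | g q <= g p].
have AE p : A p -> S p /\ g p = g q.
  by move=> [Sp /= gp]; split=> //; apply/eqP; rewrite eq_le gmax.
have clA : closed A by exact: closed_superlevel.
have oA : open A.
  rewrite openE => p /AE[Sp gp]; rewrite /interior.
  by apply: filterS (loc p Sp gp) => p' [Sp' gp']; split; rewrite //= gp' gp.
have AT : A = setT.
  apply: cT; first by exists q; split=> /=.
  - by exists A => //; rewrite setTI.
  - by exists A => //; rewrite setTI.
by move=> b; apply: AE; rewrite AT.
Qed.

End WithinContinuity.

(** * Comparison of harmonic functions on M(+) *)

Section Comparison.
Context {R : realType} {M : surface R} (f : M -> 'rV[R]_3).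
Hypothesis M_connected : connected [set: M].
Hypothesis f_imm : immersion f.
Hypothesis f_proper : proper_map f.
Hypothesis f_min : minimal f.
Hypothesis boundary_neq0 : Mplus_boundary f !=set0.
Implicit Types (p q : M).

Lemma coord_continuous_at k p : {for p, continuous (fun q => f q 0 k : R^o)}.
Proof.
apply: (@continuous_comp _ _ _ f (fun x : 'rV[R]_3 => x 0 k)).
  exact: smooth_map_continuous f_imm.1.
exact: coord_continuous.
Qed.

Lemma horizontal2_continuous_at p : {for p, continuous (horizontal2 f : M -> R^o)}.
Proof.
by apply: continuousD; apply: continuousM; exact: coord_continuous_at.
Qed.

Lemma closed_ge_on (h : M -> R^o) (c : R) : (forall p, {for p, continuous h}) ->
  closed [set p | c <= h p].
Proof.
move=> hc; apply: (@closed_comp _ _ h [set x | c <= x]); last exact: closed_ge.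
by move=> p _; exact: hc.
Qed.

Lemma closed_le_on (h : M -> R^o) (c : R) : (forall p, {for p, continuous h}) ->
  closed [set p | h p <= c].
Proof.
move=> hc; apply: (@closed_comp _ _ h [set x | x <= c]); last exact: closed_le.
by move=> p _; exact: hc.
Qed.

Lemma open_gt_on (h : M -> R^o) (c : R) : (forall p, {for p, continuous h}) ->
  open [set p | c < h p].
Proof.
move=> hc; apply: (@open_comp _ _ h [set x | c < x]); last exact: open_gt.
by move=> p _; exact: hc.
Qed.

Lemma open_lt_on (h : M -> R^o) (c : R) : (forall p, {for p, continuous h}) ->
  open [set p | h p < c].
Proof.
move=> hc; apply: (@open_comp _ _ h [set x | x < c]); last exact: open_lt.
by move=> p _; exact: hc.
Qed.

Lemma MplusDE : Mplus f `\` Mplus_boundary f =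
  surface_interior `&` [set p | 0 < x3 f p].
Proof.
apply/seteqP; split=> p.
  move=> [Sp /not_orP[nb /eqP n0]]; split.
    by apply: contrapT => ni; apply: nb.
  by rewrite /= lt_neqAle eq_sym n0.
move=> [ip /= p0]; split; first exact: ltW.
by move=> [[]//|/= h]; move: p0; rewrite h ltxx.
Qed.

Definition slab (N : R) : set M := [set p | 0 <= x3 f p] `&` [set p | x3 f p <= N].

Lemma closed_slab N : closed (slab N).
Proof.
by apply: closedI; [apply: closed_ge_on|apply: closed_le_on] => p;
  exact: coord_continuous_at.
Qed.

(** Properness enters here: the slab is bounded in the vertical direction and
    the cylinder in the horizontal ones. *)
Lemma compact_slab_cylinder (N Q : R) (S : set M) : closed S ->
  S `<=` slab N -> (forall p, S p -> horizontal2 f p <= Q) -> compact S.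
Proof.
move=> clS Sslab SQ.
have [->|/set0P[p0 Sp0]] := eqVneq S set0; first exact: compact0.
have N0 : 0 <= N by have [/= h1 h2] := Sslab _ Sp0; exact: le_trans h2.
have Q0 : 0 <= Q.
  by apply: le_trans (SQ _ Sp0); rewrite addr_ge0// -expr2 sqr_ge0.
pose r := N + Q + 1.
apply: (subclosed_compact clS (f_proper (@compact_norm_ball R 3 0 r))).
move=> p Sp /=; rewrite subr0; have [/= h1 h2] := Sslab _ Sp; have hQ := SQ _ Sp.
have sq (t : R) : t * t <= Q -> `|t| <= r.
  move=> tQ; have : `|t| * `|t| <= Q by rewrite -normrM ger0_norm// -expr2 sqr_ge0.
  move: `|t| (normr_ge0 t) => u u0 uQ; rewrite /r.
  have [u1|u1] := leP u 1; first lra.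
  have : u <= u * u by rewrite ler_peMr// ltW.
  lra.
apply: norm_rV_le; first by rewrite /r; lra.
apply: ord3P.
- by apply: sq; apply: le_trans hQ; rewrite lerDl -expr2 sqr_ge0.
- by apply: sq; apply: le_trans hQ; rewrite lerDr -expr2 sqr_ge0.
- by rewrite -[f p 0 2]/(x3 f p) ger0_norm// /r; lra.
Qed.

Section Functions.
Variables (u v : M -> R) (C : R).
Hypothesis uv_le : forall p, Mplus f p -> u p - v p <= C.
Hypothesis u_cont : {within Mplus f, continuous u}.
Hypothesis v_cont : {within Mplus f, continuous v}.
Hypothesis u_harm : harmonic_on (induced_metric f) (Mplus f `\` Mplus_boundary f) u.
Hypothesis v_harm : harmonic_on (induced_metric f) (Mplus f `\` Mplus_boundary f) v.
Hypothesis uv_boundary : forall p, Mplus_boundary f p -> u p = v p.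
Hypothesis C_ge0 : 0 <= C.

Variable N : R.
Hypothesis N_gt0 : 0 < N.

(** The slope is such that the function is nonpositive at height N when u - v
    is at most C.  The factors 1 and -1 present it as a combination of harmonic
    functions. *)
Definition tilted p : R := 1 * u p + -1 * v p + - (C / N) * x3 f p.

Let Mplus_inner := surface_interior `&` [set p | 0 < x3 f p].

Lemma slab_sub_Mplus : slab N `<=` Mplus f.
Proof. by move=> p []. Qed.

Lemma tilted_le p : slab N p -> tilted p <= C.
Proof.
move=> [/= h1 h2]; rewrite /tilted mul1r mulN1r mulNr.
by rewrite lerBlDr (le_trans (uv_le h1))// lerDl mulr_ge0// divr_ge0// ltW.
Qed.

(** On the boundary of M(+) the functions u and v agree, and at height N the
    linear term compensates the bound C. *)
Lemma tilted_le0 p : slab N p -> Mplus_boundary f p \/ x3 f p = N -> tilted p <= 0.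
Proof.
move=> [/= h1 h2]; rewrite /tilted mul1r mulN1r mulNr subr_le0 => -[/uv_boundary ->|->].
  by rewrite subrr mulr_ge0// divr_ge0// ltW.
by rewrite divfK ?gt_eqF// uv_le.
Qed.

Lemma tilted_pos_inner p : slab N p -> 0 < tilted p -> Mplus_inner p /\ x3 f p < N.
Proof.
move=> sp tp; split.
  rewrite /Mplus_inner -MplusDE; split; first exact: slab_sub_Mplus.
  by move=> Bp; move: tp; rewrite ltNge tilted_le0//; left.
rewrite lt_neqAle; have [_ /= ->] := sp; rewrite andbT; apply/eqP => pN.
by move: tp; rewrite ltNge tilted_le0//; right.
Qed.

Lemma tilted_continuous : {within slab N, continuous tilted}.
Proof.
apply: within_continuousD; [apply: within_continuousD|].
- exact: within_continuousZ (continuous_subspaceW slab_sub_Mplus u_cont).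
- exact: within_continuousZ (continuous_subspaceW slab_sub_Mplus v_cont).
- by apply: within_continuousZ; apply: continuous_for_within => p _;
    exact: coord_continuous_at.
Qed.

Lemma tilted_subharmonic : subharmonic_on f Mplus_inner tilted.
Proof.
rewrite /Mplus_inner -MplusDE.
exact: (subharmonic_onD f_imm (subharmonic_onD f_imm
  (harmonic_subharmonic f_imm 1 u_harm)
  (harmonic_subharmonic f_imm (-1) v_harm))
  (height_subharmonic f_imm f_min (W := _) (- (C / N)))).
Qed.

Lemma open_Mplus_inner : open Mplus_inner.
Proof.
apply: openI; first exact: open_surface_interior.
by apply: open_gt_on => p; exact: coord_continuous_at.
Qed.

(** If all the maximum points of g on S lie in an open part W of the interior
    of M(+) where g is subharmonic, then they fill M, by Hopf's principle and
    connectedness.  But M contains a boundary point of M(+), which is not in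
    W. *)
Lemma no_interior_max (S : set M) (g : M -> R) (W : set M) q : closed S -> 
  {within S, continuous g} -> S q -> (forall p, S p -> g p <= g q) ->
  open W -> W `<=` Mplus_inner -> W `<=` S -> subharmonic_on f W g ->
  (forall p, S p -> g p = g q -> W p) -> False.
Proof.
move=> clS cg Sq gmax oW Wint WS sg gW.
have [b Bb] := boundary_neq0.
have [|Sb gb] := connected_max M_connected clS cg Sq gmax _ b; last first.
  have : Mplus_inner b by apply: Wint; exact: gW.
  by rewrite /Mplus_inner -MplusDE => -[].
move=> p Sp gp; have Wp := gW p Sp gp.
have loc : \forall p' \near p, g p' = g p.
  have ip : surface_interior p by have [] := Wint p Wp.
  have Wmax p' : W p' -> g p' <= g p by move=> /WS/gmax; rewrite gp.
  exact: (subharmonic_max_locally_constant f_imm oW Wp ip sg Wmax).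
have nW : \forall p' \near p, W p' by exact: open_nbhs_nbhs.
by move: loc nW; apply: filterS2 => p' ? /WS.
Qed.

Lemma tilted_no_positive_max q : slab N q -> 0 < tilted q ->
  (forall p, slab N p -> tilted p <= tilted q) -> False.
Proof.
move=> sq q0 qmax.
pose W := Mplus_inner `&` [set p | x3 f p < N].
have WS : W `<=` slab N by move=> p [[_ /= h1] /= h2]; split; exact: ltW.
apply: (no_interior_max (W := W) (@closed_slab N) tilted_continuous sq qmax).
- by apply: openI; [exact: open_Mplus_inner|apply: open_lt_on => p; exact: coord_continuous_at].
- by move=> p [].
- exact: WS.
- by apply: subharmonic_on_subset tilted_subharmonic => p [].
- by move=> p sp pq; apply: tilted_pos_inner; rewrite // pq.
Qed.

(** The part of the slab outside the cylinder r < 1 is parabolic.  If the tilted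
    function exceeds m at p1, then so does its difference with a small multiple
    e of log r - x3^2, even after allowing for the lower bound -N^2 of the
    latter.  That difference is subharmonic and tends to minus infinity at
    infinity, hence it has a maximum; but there the tilted function still
    exceeds m >= 0, so the maximum is attained neither on the cylinder nor on
    the boundary. *)
Lemma tilted_le_cylinder_max (m : R) : 0 <= m ->
  (forall p, slab N p -> horizontal2 f p <= 1 -> tilted p <= m) ->
  forall p, slab N p -> tilted p <= m.
Proof.
move=> m0 mK p1 sp1; rewrite leNgt; apply/negP => mp1.
have rho1 : 1 < horizontal2 f p1.
  by rewrite ltNge; apply/negP => /(mK _ sp1); rewrite leNgt mp1.
have sqN p : slab N p -> x3 f p * x3 f p <= N * N.
  by move=> [/= h1 h2]; rewrite ler_pM.
have height_ge p : slab N p -> 1 <= horizontal2 f p -> - (N * N) <= log_height f p.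
  move=> sp rp; rewrite /log_height mulN1r; have := sqN p sp.
  by have : 0 <= ln (horizontal2 f p) by [exact: ln_ge0]; lra.
pose A := log_height f p1 + N * N.
have A0 : 0 <= A by have := height_ge p1 sp1 (ltW rho1); rewrite /A; lra.
(* With this e, the loss e A at p1 is less than half of the excess over m. *)
pose e := (tilted p1 - m) / (2 * (A + 1)).
have e0 : 0 < e by rewrite divr_gt0// ?subr_gt0// mulr_gt0//; lra.
have eA : tilted p1 - e * A > m.
  have : e * (2 * (A + 1)) = tilted p1 - m by rewrite divfK// gt_eqF//; lra.
  have := mulr_ge0 (ltW e0) A0; lra.
pose g p := tilted p + - e * log_height f p.
have gp1 : m < g p1 - e * (N * N) by move: eA; rewrite /g /A; lra.
pose T := slab N `&` [set p | 1 <= horizontal2 f p].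
have clT : closed T.
  apply: closedI; first exact: closed_slab.
  by apply: closed_ge_on => p; exact: horizontal2_continuous_at.
have Tp1 : T p1 by split=> //; exact: ltW.
have cg : {within T, continuous g}.
  apply: within_continuousD.
    by apply: continuous_subspaceW tilted_continuous => p [].
  apply: within_continuousZ; apply: continuous_for_within => p [_ /= rp].
  apply: continuousD; apply: continuousM; try exact: cst_continuous.
    apply: continuous_comp; first exact: horizontal2_continuous_at.
    by apply: continuous_ln; exact: lt_le_trans rp.
  by apply: continuousM; exact: coord_continuous_at.
(* Where g is at least g p1, log r - x3^2 is at most (C - g p1) / e, which
   bounds r^2 by Q. *)
pose Q := expR (2 * ((C - g p1) / e + N * N)).
pose T' := T `&` [set p | horizontal2 f p <= Q].
have gQ p : T p -> g p1 <= g p -> horizontal2 f p <= Q.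
  move=> [sp /= rp] gp; have rp0 : 0 < horizontal2 f p by exact: lt_le_trans rp.
  rewrite -[leLHS](lnK rp0) ler_expR.
  have tC := tilted_le sp.
  have : e * log_height f p <= C - g p1 by move: gp; rewrite /g; lra.
  rewrite mulrC -ler_pdivlMr// /log_height => h.
  by have := sqN p sp; lra.
have T'p1 : T' p1 by split=> //; exact: gQ.
have cT' : compact T'.
  apply: (@compact_slab_cylinder N Q).
  - by apply: closedI => //; apply: closed_le_on => p; exact: horizontal2_continuous_at.
  - by move=> p [[]].
  - by move=> p [].
have T'T : T' `<=` T by move=> p [].
have [q [Tq _] qmax'] := exists_max_on (ex_intro _ p1 T'p1) cT'
  (continuous_subspaceW T'T cg).
have qp1 : g p1 <= g q by exact: qmax'.
have qmax p : T p -> g p <= g q.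
  move=> Tp; have [gp|/ltW gp] := leP (g p1) (g p); last exact: le_trans qp1.
  by apply: qmax'; split=> //; exact: gQ.
pose W := Mplus_inner `&` [set p | x3 f p < N] `&` [set p | 1 < horizontal2 f p].
have WT : W `<=` T.
  by move=> p [[[_ /= h1] /= h2] /= h3]; split; [split|]; exact: ltW.
apply: (no_interior_max (W := W) clT cg Tq qmax).
- apply: openI; first apply: openI; first exact: open_Mplus_inner.
    by apply: open_lt_on => p; exact: coord_continuous_at.
  by apply: open_gt_on => p; exact: horizontal2_continuous_at.
- by move=> p [[]].
- exact: WT.
- apply: (subharmonic_onD f_imm).
    by apply: subharmonic_on_subset tilted_subharmonic => p [[]].
  apply: (log_height_subharmonic f_imm f_min); first by rewrite oppr_le0 ltW.
  by move=> p [_ /= /ltW].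
- move=> p [sp /= rp] pq.
  have mp : m < tilted p.
    have gp : g p1 <= g p by rewrite pq.
    have gE : g p = tilted p + - e * log_height f p by [].
    have hp : e * - (N * N) <= e * log_height f p by rewrite ler_pM2l// height_ge.
    by move: gp1 gp gE hp; lra.
  have [ip pN] := tilted_pos_inner sp (le_lt_trans m0 mp).
  split; first by split.
  by rewrite /= ltNge; apply/negP => /(mK _ sp); rewrite leNgt mp.
Qed.

(** By [tilted_le_cylinder_max] the supremum of the tilted function, if
    positive, is the maximum over the compact part of the slab inside the
    cylinder, and [tilted_no_positive_max] excludes it. *)
Lemma tilted_nonpos p : slab N p -> tilted p <= 0.
Proof.
move=> sp; rewrite leNgt; apply/negP => tp.
pose K := slab N `&` [set p | horizontal2 f p <= 1].
have Ks : K `<=` slab N by move=> q [].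
have cK : compact K.
  apply: (@compact_slab_cylinder N 1); [|by move=> q []|by move=> q []].
  apply: closedI; first exact: closed_slab.
  by apply: closed_le_on => q; exact: horizontal2_continuous_at.
have [K0|/set0P Kn] := eqVneq K set0.
  suff : tilted p <= 0 by rewrite leNgt tp.
  apply: tilted_le_cylinder_max => // q sq rq.
  by have : K q by []; rewrite K0.
have [q [sq rq] qmax] := exists_max_on Kn cK
  (continuous_subspaceW Ks tilted_continuous).
have H := tilted_le_cylinder_max (m := Num.max 0 (tilted q)).
have le_max p' : slab N p' -> tilted p' <= Num.max 0 (tilted q).
  apply: H; first by rewrite le_max lexx.
  by move=> k sk rk; rewrite le_max qmax ?orbT.
have [q0|q0] := leP (tilted q) 0.
  by have := le_max p sp; rewrite max_l// leNgt tp.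
apply: (tilted_no_positive_max sq q0) => k /le_max.
by rewrite max_r// ltW.
Qed.

End Functions.

(** If u exceeded v at p, the tilted function would be positive at p as soon as
    the height N of the slab is large. *)
Lemma comparison (u v : M -> R) (C : R) :
  (forall p, Mplus f p -> u p - v p <= C) ->
  {within Mplus f, continuous u} -> {within Mplus f, continuous v} ->
  harmonic_on (induced_metric f) (Mplus f `\` Mplus_boundary f) u ->
  harmonic_on (induced_metric f) (Mplus f `\` Mplus_boundary f) v ->
  (forall p, Mplus_boundary f p -> u p = v p) -> 0 <= C ->
  forall p, Mplus f p -> u p <= v p.
Proof.
move=> uvC uc vc uh vh uvB C0 p p0; rewrite leNgt; apply/negP => uvp.
have d0 : 0 < u p - v p by rewrite subr_gt0.
have x0 : 0 <= x3 f p by [].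
pose N := x3 f p + 1 + C * x3 f p / (u p - v p).
have Cd : 0 <= C * x3 f p / (u p - v p) by rewrite divr_ge0 ?mulr_ge0// ltW.
have N0 : 0 < N by rewrite /N; lra.
have sp : slab N p by split=> //=; rewrite /N; lra.
have := tilted_nonpos uvC uc vc uh vh uvB C0 N0 sp.
rewrite /tilted mul1r mulN1r mulNr subr_le0 leNgt => /negP; apply.
rewrite mulrAC ltr_pdivrMr// -ltr_pdivrMl// mulrC.
rewrite /N; lra.
Qed.

End Comparison.

Theorem theorem3p1 (R : realType) (M : surface R) (f : M -> 'rV[R]_3)
    (M_connected : connected [set: M])
    (f_immersion : immersion f) (f_proper : proper_map f)
    (f_minimal : minimal f) (boundary_neq0 : Mplus_boundary f !=set0) :
  parabolic (induced_metric f) (Mplus f) (Mplus_boundary f).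
Proof.
move=> u v ub vb uc vc uh vh uvB p Sp.
have [Cu Cu0 uC] : exists2 C, 0 <= C & forall q, Mplus f q -> `|u q| <= C.
  by have [C C0 H] := ex_strict_bound_gt0 ub; exists C; [exact: ltW|move=> q /H/ltW].
have [Cv Cv0 vC] : exists2 C, 0 <= C & forall q, Mplus f q -> `|v q| <= C.
  by have [C C0 H] := ex_strict_bound_gt0 vb; exists C; [exact: ltW|move=> q /H/ltW].
have C0 : 0 <= Cu + Cv by exact: addr_ge0.
have bd (a b : R) : `|a| <= Cu -> `|b| <= Cv -> a - b <= Cu + Cv /\ b - a <= Cu + Cv.
  by rewrite !ler_norml => /andP[? ?] /andP[? ?]; lra.
apply/eqP; rewrite eq_le; apply/andP; split.
- apply: (comparison M_connected f_immersion f_proper f_minimal boundary_neq0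
    _ uc vc uh vh uvB C0 Sp) => q Sq.
  by have [] := bd _ _ (uC q Sq) (vC q Sq).
- apply: (comparison M_connected f_immersion f_proper f_minimal boundary_neq0
    _ vc uc vh uh _ C0 Sp) => [q Sq|q /uvB //].
  by have [] := bd _ _ (uC q Sq) (vC q Sq).
Qed.
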